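(* Let $(F_n)_{n\ge 0}$ be the Fibonacci sequence ($F_0=0$, $F_1=1$, $F_{n+2}=F_{n+1}+F_n$), and for $x\ge 1$ let \[A(x):=\#\{n\le x:\ n \text{ is a positive integer and } n \mid F_n\}.\] Then, as $x\to\infty$, \[\log A(x)\le \log x-\left(\frac12+o(1)\right)\frac{\log x\,\log\log\log x}{\log\log x}.\] That is, there is a function $\varepsilon(x)\to 0$ as $x\to\infty$ such that for all sufficiently large $x$, $A(x)\le x^{1-(1/2+\varepsilon(x))\log\log\log x/\log\log x}$.
   Context: $F_n$ denotes the $n$-th Fibonacci number; $\log$ is the natural logarithm. *)

(* Defs.v *)
From Stdlib Require Import Reals Arith List.
Open Scope R_scope.

Fixpoint fib (n : nat) : nat :=
  match n with
  | O => O
  | S m => match m with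
           | O => 1%nat
           | S k => (fib m + fib k)%nat
           end
  end.

Definition A_count (N : nat) : nat :=
  length (filter (fun n => Nat.eqb (fib n mod n) 0) (seq 1 N)).

Definition A (x : R) : nat := A_count (Z.to_nat (Int_part x)).

(* Main.v *)
From HB Require Import structures.
Require Import Defs.
From Stdlib Require Import Reals Lra ZArith.
From mathcomp Require Import all_boot all_algebra.
From mathcomp Require Import zify.
From mathcomp Require ring.

(** Let [rank n] be the rank of apparition of [n]: the least [j > 0] with
    [n %| fib j]. Then [n %| fib n] iff [rank n %| n]; put [m = rank n] and
    [k = n / m]. Write [X = ln x], [Y = ln X], [W = ln Y] and
    [u = (1/2 - delta) W / Y], and split at [k = x ^ (1 - u)].

    If [k] is small, count by [k]: since [p] does not divide [rank p] for a prime
    [p <> 5], the part of [n] prime to [30 k] is determined by [k], and by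
    Rankin's method at most [exp (O (X / Y))] integers up to [x] have all their
    prime factors dividing [30 k].

    If [k] is large then [m <= x ^ u], and every prime [p] dividing [k] satisfies
    [rank p %| m]. Rankin's method with exponent [1 - u], as in Pomerance's work
    on pseudoprimes, bounds the number of such [k <= x / m]: the primes of rank
    [d] are congruent to [0] or [1] or [-1] modulo [d] and there are at most [d]
    of them, so that the sum of [p ^ - (1 - u)] over them is
    [O (d ^ - (1 - 2 u) / u)], and by Chebyshev's bound the sum of
    [d ^ - (1 - 2 u)] over the divisors [d] of [m] is [X ^ o (1)]. *)

(** * Ranks of apparition *)

Section RankOfApparition.
Import GRing.Theory mathcomp.algebra_tactics.ring.
Local Open Scope nat_scope.

(** * Divisibility among Fibonacci numbers *)

Lemma fibSS n : fib n.+2 = fib n.+1 + fib n.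
Proof. by []. Qed.

Lemma fibD m n : fib (m + n).+1 = fib m.+1 * fib n.+1 + fib m * fib n.
Proof.
elim: m n => [|m IHm] n; first by rewrite add0n /=; lia.
by rewrite addSnnS IHm !fibSS; lia.
Qed.

Lemma fib_gt0 n : 0 < n -> 0 < fib n.
Proof.
case: n => // n _; elim: n => // n IHn; rewrite fibSS; lia.
Qed.

Lemma fib_lt_exp n : fib n < 2 ^ n.
Proof.
suff: fib n < 2 ^ n /\ fib n.+1 <= 2 ^ n by case.
elim: n => [|n [IH1 IH2]] //; rewrite fibSS expnS; lia.
Qed.

Lemma coprime_fibS n : coprime (fib n) (fib n.+1).
Proof.
elim: n => // n IHn; by rewrite fibSS /coprime gcdnDl gcdnC.
Qed.

(** One subtraction step of Euclid's algorithm on the indices: modulo [fib n] only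
    [fib m * fib n.+1], up to a shift of [m], survives in [fibD], and [fib n.+1] is coprime to
    [fib n]. *)
Lemma gcdn_fibD m n : gcdn (fib (m + n)) (fib n) = gcdn (fib m) (fib n).
Proof.
case: m => [|m]; first by rewrite add0n gcdnn gcd0n.
rewrite addSn fibD addnC gcdnC gcdnMDl Gauss_gcdl; last exact: coprime_fibS.
by rewrite gcdnC.
Qed.

Lemma gcdn_fib m n : gcdn (fib m) (fib n) = fib (gcdn m n).
Proof.
have [s] := ubnP (m + n); elim: s m n => // s IHs m n lt_s.
wlog le_nm : m n lt_s / n <= m => [hw|].
  have [/hw->//|/ltnW le_mn] := leqP n m.
  by rewrite gcdnC [in RHS]gcdnC hw // addnC.
have [->|n_gt0] := posnP n; first by rewrite !gcdn0.
by rewrite -{1}(subnK le_nm) gcdn_fibD IHs; [rewrite -{2}(subnK le_nm) gcdnC [in RHS]gcdnC gcdnDr | lia].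
Qed.

Lemma dvdn_fib m n : m %| n -> fib m %| fib n.
Proof. by move=> /gcdn_idPl eq_m; rewrite -eq_m -gcdn_fib dvdn_gcdr. Qed.

Lemma fibMS_mod m j : fib (m * j).+1 = fib m.+1 ^ j %[mod fib m].
Proof.
elim: j => [|j IHj]; first by rewrite muln0.
by rewrite mulnS fibD expnS [fib m * _]mulnC addnC modnMDl -modnMmr IHj modnMmr.
Qed.

(** The quotient [c] is needed modulo [fib m], not just its existence: it shows that any divisor of
    both [j] and [fib m] divides [c], which drives [dvdn_fib_mul]. *)
Lemma fibM_mod m j : 0 < m ->
  exists2 c, fib (m * j) = fib m * c & c = j * fib m.+1 ^ j.-1 %[mod fib m].
Proof.
move=> m_gt0; have d_gt0 := fib_gt0 _ m_gt0.
elim: j => [|j [c IHc IH]]; first by exists 0; rewrite ?muln0.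
(* Addition formula with F_(m-1) = F_(m+1) - F_m, arranged to avoid subtraction in [nat]. *)
have E : fib (m * j.+1) + fib m * fib (m * j) =
    fib m * fib (m * j).+1 + fib m.+1 * fib (m * j).
  rewrite mulnS. case: (m) m_gt0 => // k _; rewrite addSn fibD fibSS; ring.
have /dvdnP[c'] : fib m %| fib (m * j.+1) by rewrite dvdn_fib ?dvdn_mulr.
rewrite [c' * _]mulnC => Dc'; exists c' => //.
have {}E : c' + c * fib m = fib (m * j).+1 + fib m.+1 * c.
  apply/eqP; rewrite -(eqn_pmul2l d_gt0); apply/eqP.
  by move: E; rewrite Dc' IHc; lia.
rewrite -(modnMDl c c') addnC E -modnDm fibMS_mod -[in X in _ + X]modnMmr IH.
rewrite modnMmr modnDm; congr (_ %% _); case: j {IHc IH Dc' E} => [|j] /=.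
  by rewrite !mul0n muln0.
by rewrite (mulSn j.+1) mulnCA -expnS.
Qed.

(** The cofactor of [fib m] in [fib (m * q)] is a multiple of [q] modulo [fib m], hence modulo
    [q]. *)
Lemma dvdn_fib_mul m n q : q %| fib m -> n %| fib m -> n * q %| fib (m * q).
Proof.
have [->|m_gt0] := posnP m; first by rewrite mul0n !dvdn0.
move=> dv_q dv_n; have [c -> Dc] := fibM_mod _ q m_gt0.
apply: dvdn_mul => //.
by rewrite /dvdn -(modn_dvdm c dv_q) Dc modn_dvdm // modnMr.
Qed.

(** The power n + 1 of the Fibonacci matrix; the shift by one avoids the index -1 in the corner. *)
Definition fib_mx (R : nzRingType) n : 'M[R]_2 :=
  (\matrix_(i, j) (fib (n + (i == 0 :> nat) + (j == 0 :> nat)))%:R)%R.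

Lemma fib_mxX (R : nzRingType) n : (fib_mx R 0 ^+ n.+1 = fib_mx R n)%R.
Proof.
elim: n => [|n IHn]; first by rewrite expr1.
rewrite exprS IHn; apply/matrixP=> i j; rewrite !mxE big_ord_recl big_ord1 !mxE.
case: i => [[|[|i]] ?] //; case: j => [[|[|j]] ?] //;
  by rewrite /= ?addn1 ?addn0 ?add0n ?mul1r ?mul0r ?addr0 -?natrD.
Qed.

(* Frobenius applied to the square root [2 Q - 1] of 5 in 2x2 matrices over
   [F], where [Q] is the Fibonacci matrix. *)
Lemma pchar_fib (F : fieldType) p : p \in [char F]%R -> odd p ->
  (5%:R != 0 :> F)%R -> ((fib p.-1)%:R * (fib p.+1)%:R = 0 :> F)%R.
Proof.
move=> chF p_odd F5; pose Q := fib_mx F 0.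
have p_gt0 : 0 < p by case: (p) p_odd.
have chM : p \in [char 'M[F]_2]%R by rewrite pchar_lalg.
have FX n : (n%:R ^+ p = n%:R :> F)%R.
  by rewrite -(pFrobenius_autE chF) pFrobenius_aut_nat.
pose S : 'M[F]_2 := (2%:R *: Q - 1)%R.
(* By Euler's criterion this is the Legendre symbol of 5 modulo p; only e^2 = 1 is used. *)
pose e : F := (5%:R ^+ p./2)%R.
have SS : (S * S = 5%:R *: 1)%R.
  apply/matrixP=> i j; rewrite !mxE big_ord_recl big_ord1 !mxE.
  case: i => [[|[|i]] ?] //; case: j => [[|[|j]] ?] //=; rewrite ?mulr1n ?mulr0n; ring.
have pE : p = (1 + 2 * p./2)%N by rewrite mul2n -{1}(odd_double_half p) p_odd.
have SX : (S ^+ p = e *: S)%R.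
  by rewrite {1}pE exprD expr1 exprM expr2 SS exprZn expr1n -scalerAr mulr1.
have QX : (2%:R *: fib_mx F p.-1 = 1 + e *: S)%R.
  rewrite -fib_mxX prednK // -SX -{1}(FX 2) -exprZn.
  have -> : (2%:R *: fib_mx F 0 = 1 + S)%R by rewrite /S addrC subrK.
  rewrite -!(pFrobenius_autE chM) pFrobenius_autD_comm ?pFrobenius_aut1 //.
  exact: commr_sym (commr1 _).
have e2 : (e * e = 1)%R.
  have /eqP := FX 5; rewrite {1}pE exprD expr1 mul2n -addnn exprD -/e.
  rewrite -subr_eq0 -[X in (_ - X)%R]mulr1 -mulrBr mulf_eq0 (negPf F5) /=.
  by rewrite subr_eq0 => /eqP.
have F2 : (2%:R != 0 :> F)%R.
  rewrite -(dvdn_pcharf chF); apply/negP=> p_2; have p_le2 := dvdn_leq (isT : 0 < 2) p_2.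
  by case: (p) p_odd p_le2 chF {p_2} => [|[|[|]]].
(* The diagonal entries read 2 F_(p+1) = 1 + e and 2 F_(p-1) = 1 - e, with product proportional to 1
   - e^2 = 0. *)
have := congr1 (fun M : 'M_2 => M ord0 ord0) QX.
have := congr1 (fun M : 'M_2 => M ord_max ord_max) QX.
rewrite !mxE /= !addn0 !addn1 prednK // !mulr1n => E1 E2.
have : (2%:R * 2%:R * ((fib p.-1)%:R * (fib p.+1)%:R) = 0 :> F)%R.
  transitivity ((1 - e) * (1 + e))%R; last by rewrite -subr_sqr expr1n expr2 e2 subrr.
  transitivity ((2%:R * (fib p.-1)%:R) * (2%:R * (fib p.+1)%:R) : F)%R; first by ring.
  rewrite E1 E2; ring.
by move/eqP; rewrite !mulf_eq0 (negPf F2) /= -mulf_eq0 => /eqP.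
Qed.

Lemma prime_dvdn_fib p : prime p -> p != 5 ->
  (p %| fib p.-1) || (p %| fib p.+1).
Proof.
move=> p_pr p_n5; have [->//|p_n2] := eqVneq p 2.
have p_odd : odd p by case: (even_prime p_pr) p_n2 => [->|].
have chF := pchar_Fp p_pr; rewrite !(dvdn_pcharf chF) -mulf_eq0.
by rewrite (pchar_fib _ p) // -(dvdn_pcharf chF) dvdn_prime2.
Qed.

(** Induction on n: if i works for a prime factor p and j for n / p, then i j p works for n by
    [dvdn_fib_mul]. *)
Lemma fib_multiple_exists n : 0 < n -> exists j, (0 < j) && (n %| fib j).
Proof.
have [s] := ubnP n; elim: s n => // s IHs n lt_ns n_gt0.
have [n_le1|n_gt1] := leqP n 1; first by exists 1; have -> : n = 1 by lia.
have p_pr := pdiv_prime n_gt1; set p := pdiv n in p_pr.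
have [i i_gt0 p_fi] : exists2 i, 0 < i & p %| fib i.
  have [->|p_n5] := eqVneq p 5; first by exists 5.
  have p_gt1 := prime_gt1 p_pr.
  by case/orP: (prime_dvdn_fib _ p_pr p_n5) => ?; [exists p.-1 | exists p.+1]; rewrite //; lia.
have nE : n = n %/ p * p by rewrite divnK ?pdiv_dvd.
have n'_gt0 : 0 < n %/ p by rewrite divn_gt0 ?prime_gt0 ?pdiv_leq.
have [|j /andP[j_gt0 n'_fj]] := IHs (n %/ p) _ n'_gt0.
  by have := ltn_Pdiv (prime_gt1 p_pr) n_gt0; lia.
exists (i * j * p); rewrite !muln_gt0 i_gt0 j_gt0 prime_gt0 //= nE.
apply: dvdn_fib_mul; last by apply: (dvdn_trans n'_fj); rewrite dvdn_fib ?dvdn_mull.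
by apply: (dvdn_trans p_fi); rewrite dvdn_fib ?dvdn_mulr.
Qed.

(* [rank 0 = 0] makes [dvdn_rank] hold for [n = 0] too, as [fib 0 = 0]. *)
Definition rank (n : nat) : nat :=
  if n is m.+1 then ex_minn (fib_multiple_exists m.+1 isT) else 0.

Lemma rank_gt0 n : 0 < n -> 0 < rank n.
Proof. by case: n => //= n _; case: ex_minnP => j /andP[]. Qed.

(** By [gcdn_fib], the gcd of [rank n] and [j] is again an admissible index, so minimality makes it
    equal to [rank n]. *)
Lemma dvdn_rank n j : (rank n %| j) = (n %| fib j).
Proof.
case: n => [|n] /=.
  rewrite !dvd0n; case: j => // j; symmetry; apply/negbTE.
  by rewrite -lt0n fib_gt0.
case: ex_minnP => r /andP[r_gt0 n_r] r_min.
apply/idP/idP=> [/dvdn_fib|n_j]; first exact: dvdn_trans.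
have /r_min: (0 < gcdn r j) && (n.+1 %| fib (gcdn r j)).
  by rewrite gcdn_gt0 r_gt0 -gcdn_fib dvdn_gcd n_r.
move=> le_rg; suff <- : gcdn r j = r by exact: dvdn_gcdr.
by apply/eqP; rewrite eqn_leq le_rg dvdn_leq ?dvdn_gcdl.
Qed.

Lemma rank_dvd m n : m %| n -> rank m %| rank n.
Proof.
by move=> m_n; rewrite dvdn_rank (dvdn_trans m_n) // -dvdn_rank.
Qed.

Lemma rank5 : rank 5 = 5.
Proof.
have : rank 5 %| 5 by rewrite dvdn_rank.
rewrite dvdn_divisors // !inE => /orP[] /eqP // r1.
by have := dvdn_rank 5 1; rewrite r1.
Qed.

Lemma rank_prime_dvd p : prime p -> p != 5 -> (rank p %| p.-1) || (rank p %| p.+1).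
Proof. by rewrite !dvdn_rank; apply: prime_dvdn_fib. Qed.

Lemma rank_prime_le p : prime p -> rank p <= p.+1.
Proof.
move=> p_pr; have [->|p_n5] := eqVneq p 5; first by rewrite rank5.
have p_gt1 := prime_gt1 p_pr.
by case/orP: (rank_prime_dvd p p_pr p_n5) => /dvdn_leq; lia.
Qed.

Lemma prime_ndvd_rank p : prime p -> p != 5 -> ~~ (p %| rank p).
Proof.
move=> p_pr p_n5; have p_gt1 := prime_gt1 p_pr; apply/negP=> p_r.
case/orP: (rank_prime_dvd p p_pr p_n5) => /(dvdn_trans p_r).
  by move/dvdn_leq; lia.
by rewrite -addn1 dvdn_addr // dvdn1; lia.
Qed.

(** By [dvdn_fib_mul], each further factor [p] costs at most a factor [p] in the index. *)
Lemma rank_pfactor p a : 0 < a -> rank (p ^ a) %| p ^ a.-1 * rank p.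
Proof.
case: a => // a _; rewrite dvdn_rank; elim: a => [|a IHa].
  by rewrite mul1n -dvdn_rank.
rewrite expnSr [p ^ _ * rank p]mulnC [p ^ a.+1]expnSr mulnA [rank p * _]mulnC.
apply: dvdn_fib_mul; first by rewrite -dvdn_rank dvdn_mull.
by rewrite -expnSr.
Qed.

Lemma dvdn_div_prime d r p b : prime p -> p ^ b %| r -> ~~ (p ^ b %| d) ->
  d %| r -> d %| r %/ p.
Proof.
move=> p_pr pb_r npb_d /dvdnP[e rE]; move: pb_r; rewrite {}rE => pb_r.
have [/dvdnP[f ->]|np_e] := boolP (p %| e).
  by rewrite mulnAC mulnK ?prime_gt0 // dvdn_mull.
case/negP: npb_d; rewrite -(Gauss_dvdr _ (n := e)) //.
by rewrite coprimeXl // prime_coprime.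
Qed.

(* Otherwise [rank n %/ p] would be a multiple of the ranks of all prime power
   components of [n]. *)
Lemma pfactor_dvdn_rank n p b : 0 < n -> prime p -> p ^ b.+1 %| rank n ->
  exists2 q, q \in primes n & p ^ b.+1 %| rank (q ^ logn q n).
Proof.
move=> n_gt0 p_pr pb_n; have r_gt0 := rank_gt0 n n_gt0.
case: (boolP (has (fun q => p ^ b.+1 %| rank (q ^ logn q n)) (primes n))) => [/hasP//|].
move/hasPn=> npb.
have p_r : p %| rank n by apply: dvdn_trans pb_n; rewrite expnS dvdn_mulr.
have : rank n %| rank n %/ p.
  rewrite dvdn_rank; apply/dvdn_partP => // q q_n.
  rewrite p_part -dvdn_rank; apply: (dvdn_div_prime _ _ _ b.+1) => //.
    by apply: npb.
  by apply: rank_dvd; rewrite -p_part dvdn_part.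
move/dvdn_leq; rewrite divn_gt0 ?prime_gt0 // dvdn_leq // => /(_ isT).
by rewrite leqNgt ltn_Pdiv ?prime_gt1.
Qed.

Lemma prime_succ_prime q : prime q.+1 -> prime q -> q = 2.
Proof.
move=> q1_pr q_pr; case: (even_prime q_pr) => // q_odd.
case: (even_prime q1_pr) => [[q1]|]; first by rewrite q1 in q_pr.
by rewrite /= q_odd.
Qed.

(* If [p] does not divide [k], the [p]-part of [n = k * rank n] is already seen
   in the rank of some prime [q > p] dividing [n], and either [q] divides [k] or
   the statement for [q] makes [q] a divisor of [n'] as well. *)
Lemma rank_quotient_pfactor k n n' p e : 0 < n -> 0 < n' ->
  n = k * rank n -> n' = k * rank n' -> prime p -> ~~ (p %| 30 * k) ->
  p ^ e %| n -> p ^ e %| n'.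
Proof.
move=> n_gt0 n'_gt0 nE n'E.
(* Downward induction on p: the measure n - p drops on passing to a larger prime divisor q of n. *)
have [s] := ubnP (n - p); elim: s p e => // s IHs p e lt_s p_pr np_k.
case: e => // e pe_n.
have p_gt1 := prime_gt1 p_pr.
set b := logn p n.
have le_eb : e.+1 <= b by rewrite -pfactor_dvdn.
have bE : b = b.-1.+1 by lia.
have pb_n : p ^ b %| n by exact: pfactor_dvdnn.
suff : p ^ b %| n' by apply: dvdn_trans; rewrite dvdn_exp2l.
have np_k' : ~~ (p %| k) by apply: contra np_k => ?; rewrite dvdn_mull.
have cop d : ~~ (p %| d) -> coprime (p ^ b) d by move=> ?; rewrite coprimeXl // prime_coprime.
have pb_r : p ^ b %| rank n by move: pb_n; rewrite {1}nE Gauss_dvdr ?cop.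
rewrite bE in pb_r; have [q q_n] := pfactor_dvdn_rank _ _ _ n_gt0 p_pr pb_r.
rewrite -bE => pb_rq; have := q_n; rewrite mem_primes => /and3P[q_pr _ q_dv_n].
have lq_gt0 : 0 < logn q n by rewrite logn_gt0.
have := dvdn_trans pb_rq (rank_pfactor q _ lq_gt0).
(* This is what the factor 30 is for: 5 divides its own rank, and 2, 3 are the only consecutive
   primes. *)
have p_n5 : p != 5 by apply: contra np_k => /eqP->; rewrite dvdn_mulr.
have p_n2 : p != 2 by apply: contra np_k => /eqP->; rewrite dvdn_mulr.
have p_n3 : p != 3 by apply: contra np_k => /eqP->; rewrite dvdn_mulr.
(* For q = p this would give p^b | p^(b-1), as p does not divide [rank p]. *)
have [->|q_np] := eqVneq q p.
  rewrite -/b Gauss_dvdl; last by rewrite cop // prime_ndvd_rank.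
  by rewrite dvdn_Pexp2l // leqNgt ltn_predL (leq_ltn_trans (leq0n e) le_eb).
rewrite Gauss_dvdr; last first.
  by rewrite cop //; apply: contra q_np; rewrite Euclid_dvdX // => /andP[+ _]; rewrite dvdn_prime2 // eq_sym.
move=> pb_q.
have p_le : p <= q.+1.
  apply: leq_trans (rank_prime_le q q_pr); apply: leq_trans (dvdn_leq _ pb_q).
    by rewrite bE expnS leq_pmulr // expn_gt0 prime_gt0.
  exact: rank_gt0 (prime_gt0 q_pr).
have p_gt5 : 5 < p.
  by case: (p) p_pr p_n2 p_n3 p_n5 => [|[|[|[|[|[|]]]]]].
have p_lt : p < q.
  rewrite ltn_neqAle eq_sym q_np /= -ltnS ltn_neqAle p_le andbT.
  apply: contraTneq p_pr => pE; move: p_gt5; rewrite pE ltnS => q_ge5.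
  by apply: contraL q_ge5 => /prime_succ_prime -> //.
have q_n' : q %| n'.
  have [q_k|nq_k] := boolP (q %| 30 * k).
    rewrite Euclid_dvdM // in q_k; case/orP: q_k => [q_30|q_k]; last by rewrite n'E dvdn_mulr.
    have : [|| q == 2, q == 3 | q == 5].
      by rewrite -!dvdn_prime2 // orbA -!Euclid_dvdM.
    by case/or3P => /eqP qE; rewrite qE in p_lt; have := leq_trans p_gt5 (ltnW p_lt).
  rewrite -[q]expn1; apply: IHs => //.
  exact: leq_trans (ltn_sub2l (leq_trans p_lt (dvdn_leq n_gt0 q_dv_n)) p_lt) lt_s.
apply: (dvdn_trans pb_q); apply: (dvdn_trans (rank_dvd _ _ q_n')).
by rewrite {2}n'E dvdn_mull.
Qed.

Lemma rank_quotient_part k n n' : 0 < n -> 0 < n' ->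
  n = k * rank n -> n' = k * rank n' ->
  n`_(\pi(30 * k)^') = n'`_(\pi(30 * k)^').
Proof.
move=> n_gt0 n'_gt0 nE n'E; apply: eq_partn_from_log => // p p_pi.
have [p_pr|p_npr] := boolP (prime p); last by rewrite /logn !(negPf p_npr).
have np_k : ~~ (p %| 30 * k).
  apply: contra p_pi => p_k; rewrite inE /= mem_primes p_pr p_k andbT muln_gt0 /=.
  by rewrite lt0n; apply: contraTneq n_gt0 => k0; rewrite nE k0.
apply/eqP; rewrite eqn_leq -!pfactor_dvdn //.
by apply/andP; split; [apply: (rank_quotient_pfactor k n n') | apply: (rank_quotient_pfactor k n' n)];
  rewrite ?pfactor_dvdnn.
Qed.

End RankOfApparition.

Local Open Scope R_scope.

(** * Finite real sums and Rankin's method *)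

HB.instance Definition _ := Monoid.isComLaw.Build R 0 Rplus
  (fun x y z => esym (Rplus_assoc x y z)) Rplus_comm Rplus_0_l.

Notation "\rsum_ ( i <- r | P ) F" := (\big[Rplus/0]_(i <- r | P%B) F)
  (at level 41, F at level 41, i, r at level 50) : R_scope.
Notation "\rsum_ ( i <- r ) F" := (\big[Rplus/0]_(i <- r) F)
  (at level 41, F at level 41, i, r at level 50) : R_scope.

Section RealSums.
Variable T : eqType.
Implicit Types (s t : seq T) (f g : T -> R).

Lemma rsum_le s (P : pred T) f g :
  (forall i, i \in s -> P i -> f i <= g i) ->
  \rsum_(i <- s | P i) f i <= \rsum_(i <- s | P i) g i.
Proof.
move=> le_fg; rewrite big_seq_cond [X in _ <= X]big_seq_cond.
apply: (big_ind2 (fun x y => x <= y)); [lra | move=> *; lra |].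
by move=> i /andP[]; apply: le_fg.
Qed.

Lemma rsum_ge0 s (P : pred T) f :
  (forall i, i \in s -> P i -> 0 <= f i) -> 0 <= \rsum_(i <- s | P i) f i.
Proof.
move=> f_ge0; rewrite big_seq_cond.
apply: (big_ind (fun x => 0 <= x)); [lra | move=> *; lra |].
by move=> i /andP[]; apply: f_ge0.
Qed.

Lemma rsum_scale s (P : pred T) f c :
  \rsum_(i <- s | P i) (c * f i) = c * \rsum_(i <- s | P i) f i.
Proof.
by symmetry; apply: (big_morph (fun x => c * x)); [move=> *; lra | lra].
Qed.

Lemma rsum_const s c : \rsum_(i <- s) c = INR (size s) * c.
Proof.
elim: s => [|i s IHs]; first by rewrite big_nil /=; lra.
by rewrite big_cons IHs -[size (i :: s)]/(size s).+1 S_INR; lra.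
Qed.

Lemma rsum_sub s t f : uniq s -> {subset s <= t} ->
  (forall i, i \in t -> 0 <= f i) -> \rsum_(i <- s) f i <= \rsum_(i <- t) f i.
Proof.
elim: s t => [|x s IHs] t /=; first by move=> _ _ f_ge0; rewrite big_nil; apply: rsum_ge0 => *; apply: f_ge0.
move=> /andP[x_s s_uniq] s_t f_ge0.
have x_t : x \in t by apply: s_t; rewrite mem_head.
rewrite (perm_big _ (perm_to_rem x_t)) /= !big_cons.
suff : \rsum_(i <- s) f i <= \rsum_(i <- rem x t) f i by lra.
apply: IHs => // [y y_s|y /mem_rem]; last exact: f_ge0.
have : y \in t by apply: s_t; rewrite inE y_s orbT.
rewrite (perm_mem (perm_to_rem x_t)) inE => /orP[/eqP yx|//].
by rewrite yx (negPf x_s) in y_s.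
Qed.

Lemma rsum_fiber (U : eqType) s (t : seq U) (h : T -> U) f : uniq t ->
  (forall i, i \in s -> h i \in t) ->
  \rsum_(i <- s) f i = \rsum_(j <- t) \rsum_(i <- s | h i == j) f i.
Proof.
move=> t_uniq h_t; rewrite (exchange_big_dep predT) //= big_seq [RHS]big_seq.
apply: eq_bigr => i i_s; under eq_bigl do rewrite eq_sym.
by rewrite -big_filter (filter_pred1_uniq t_uniq (h_t _ i_s)) big_seq1.
Qed.

End RealSums.

Lemma leINR m n : (m <= n)%N -> INR m <= INR n.
Proof. by move/leP/le_INR. Qed.

Lemma ltINR m n : (m < n)%N -> INR m < INR n.
Proof. by move/ltP/lt_INR. Qed.

Lemma INR_gt0 n : (0 < n)%N -> 0 < INR n.
Proof. by move/ltP/lt_0_INR. Qed.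

Lemma INR_ge1 n : (0 < n)%N -> 1 <= INR n.
Proof. by move/leINR. Qed.

Lemma INRM m n : INR (m * n)%N = INR m * INR n.
Proof. exact: mult_INR. Qed.

Lemma INRX m n : INR (m ^ n)%N = INR m ^ n.
Proof. by elim: n => //= n IHn; rewrite expnS INRM IHn. Qed.

Lemma Rpower_gt0 x a : 0 < Rpower x a.
Proof. exact: exp_pos. Qed.

Lemma Rpower_lt1 x a : 1 < x -> a < 0 -> Rpower x a < 1.
Proof.
by move=> x1 a0; rewrite -(Rpower_O x); [apply: Rpower_lt | lra].
Qed.

Lemma Rpower_le_base x y a : 0 < x <= y -> 0 <= a -> Rpower x a <= Rpower y a.
Proof. by move=> xy a_ge0; apply: Rle_Rpower_l. Qed.

Lemma Rpower_neg_le x y a : 0 < x <= y -> 0 <= a -> Rpower y (- a) <= Rpower x (- a).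
Proof.
move=> xy a0; rewrite !Rpower_Ropp; apply: Rinv_le_contravar; first exact: Rpower_gt0.
exact: Rpower_le_base.
Qed.

Lemma geometric_le t n : 0 <= t < 1 -> \rsum_(e <- iota 0 n) t ^ e <= / (1 - t).
Proof.
move=> t01.
suff -> : \rsum_(e <- iota 0 n) t ^ e = (1 - t ^ n) / (1 - t).
  rewrite -[X in _ <= X]Rmult_1_l; apply: Rmult_le_compat_r.
    by apply: Rlt_le; apply: Rinv_0_lt_compat; lra.
  by have := pow_le t n; lra.
elim: n => [|n IHn]; first by rewrite big_nil /=; field; lra.
rewrite -addn1 iotaD big_cat big_seq1 IHn /= add0n pow_add; field; lra.
Qed.

(** Induction on Q: sorting [s] by the exponent of q splits off a geometric series in q^-a. The
    function [h] leaves the bound on each Euler factor to the caller. *)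
Lemma euler_product_bound (Q s : seq nat) (a : R) (h : nat -> R) :
  0 < a -> uniq Q -> all prime Q ->
  (forall q, q \in Q -> / (1 - Rpower (INR q) (- a)) <= exp (h q)) ->
  uniq s -> (forall b, b \in s -> (0 < b)%N /\ {subset primes b <= Q}) ->
  \rsum_(b <- s) Rpower (INR b) (- a) <= exp (\rsum_(q <- Q) h q).
Proof.
move=> a_gt0; elim: Q s => [|q Q IHQ] s /=.
  move=> _ _ _ s_uniq s1; rewrite big_nil exp_0.
  apply: (Rle_trans _ (\rsum_(b <- [:: 1%N]) Rpower (INR b) (- a))); last first.
    by rewrite big_seq1 /= /Rpower ln_1 Rmult_0_r exp_0; lra.
  apply: rsum_sub => // [b /s1[b_gt0 b_pr]|i _]; last by apply: Rlt_le; apply: Rpower_gt0.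
  rewrite inE; apply/eqP; have [|b_gt1] := leqP b 1; first by lia.
  by have := b_pr (pdiv b); rewrite in_nil mem_primes pdiv_prime ?pdiv_dvd //= b_gt0 => /(_ isT).
move=> /andP[q_Q Q_uniq] /andP[q_pr Q_pr] h_bd s_uniq s_Q.
have q_gt1 := prime_gt1 q_pr.
set t := Rpower (INR q) (- a).
have t_gt0 : 0 < t by exact: Rpower_gt0.
have t_lt1 : t < 1 by apply: Rpower_lt1; [apply: (ltINR 1) | lra].
pose M := (\max_(b <- s) b).+1.
have le_M b : b \in s -> (logn q b < M)%N.
  move=> b_s; rewrite ltnS; apply: leq_trans (leq_bigmax_seq _ b_s isT).
  by case: (s_Q b b_s) => b_gt0 _; apply: ltnW; apply: ltn_logl.
rewrite (rsum_fiber _ _ _ (iota 0 M) (logn q)) ?iota_uniq //; last first.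
  by move=> b b_s; rewrite mem_iota le_M.
rewrite big_cons exp_plus.
apply: (Rle_trans _ (\rsum_(e <- iota 0 M) (exp (\rsum_(q <- Q) h q) * t ^ e))).
  apply: rsum_le => e _ _.
  rewrite -big_filter.
  (* For fixed exponent e, removing the q-part is injective and leaves integers composed of the
     remaining primes. *)
  have -> : \rsum_(b <- [seq b <- s | logn q b == e]) Rpower (INR b) (- a)
     = \rsum_(b <- [seq b`_q^' | b <- s & logn q b == e]) (t ^ e * Rpower (INR b) (- a)).
    rewrite big_map big_seq [RHS]big_seq; apply: eq_bigr => b.
    rewrite mem_filter => /andP[/eqP <- b_s]; have [b_gt0 _] := s_Q b b_s.
    rewrite -{1}(partnC q b_gt0) p_part INRM INRX -Rpower_mult_distr; first last.
    - exact/INR_gt0/part_gt0.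
    - by apply: pow_lt; apply: INR_gt0; lia.
    congr (_ * _); rewrite /t -!Rpower_pow; try (apply: INR_gt0; lia); try exact: Rpower_gt0.
    rewrite !Rpower_mult; congr Rpower; lra.
  rewrite rsum_scale Rmult_comm; apply: Rmult_le_compat_r; first by apply: Rlt_le; apply: pow_lt.
  apply: IHQ => //.
  - by move=> q' q'_Q; apply: h_bd; rewrite inE q'_Q orbT.
  - rewrite map_inj_in_uniq ?filter_uniq // => b b'.
    rewrite !mem_filter => /andP[/eqP Eb b_s] /andP[/eqP Eb' b'_s] eq_bb'.
    have [b_gt0 _] := s_Q b b_s; have [b'_gt0 _] := s_Q b' b'_s.
    by rewrite -(partnC q b_gt0) -(partnC q b'_gt0) eq_bb' !p_part Eb Eb'.
  move=> b' /mapP[b]; rewrite mem_filter => /andP[_ b_s] ->; have [b_gt0 b_Q] := s_Q b b_s.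
  split; first exact: part_gt0.
  move=> p p_b; have : p \in \pi(b`_q^') by [].
  rewrite pi_of_part // !inE => /andP[/b_Q]; rewrite inE => /orP[->|//] //.
rewrite rsum_scale Rmult_comm; apply: Rmult_le_compat_r; first by apply: Rlt_le; apply: exp_pos.
apply: Rle_trans (geometric_le t M _) _; first lra.
by apply: h_bd; rewrite mem_head.
Qed.

Lemma ln_le_sub1 x : 0 < x -> ln x <= x - 1.
Proof. by move=> x_gt0; have := exp_ineq1_le (ln x); rewrite exp_ln //; lra. Qed.

Lemma exp_le x y : x <= y -> exp x <= exp y.
Proof. by case=> [/exp_increasing|->]; lra. Qed.

(* Weighted AM-GM for [t] and [1]. *)
Lemma Rpower_le_affine t u : 0 < t -> 0 < u <= 1 -> Rpower t u <= u * t + (1 - u).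
Proof.
move=> t_gt0 u01; set v := u * t + (1 - u).
have v_gt0 : 0 < v by rewrite /v; have := Rmult_lt_0_compat u t; lra.
have iv_gt0 := Rinv_0_lt_compat v v_gt0.
have E1 := ln_le_sub1 (t * / v) (Rmult_lt_0_compat _ _ t_gt0 iv_gt0).
have E2 := ln_le_sub1 (/ v) iv_gt0.
rewrite ln_mult // ln_Rinv // in E1; rewrite ln_Rinv // in E2.
rewrite -(exp_ln v) // /Rpower; apply: exp_le.
have E3 : u * (t * / v) + (1 - u) * / v = 1 by rewrite /v; field; rewrite -/v; lra.
have E4 := Rmult_le_compat_l u _ _ (Rlt_le _ _ (proj1 u01)) E1.
have E5 := Rmult_le_compat_l (1 - u) _ _ (ltac:(lra) : 0 <= 1 - u) E2.
lra.
Qed.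

(* In Stdlib, [ln 0 = 0]. *)
Lemma Rpower_0_l a : Rpower 0 a = 1.
Proof.
by rewrite /Rpower /ln; case: Rlt_dec => [/Rlt_irrefl|_] //; rewrite Rmult_0_r exp_0.
Qed.

Lemma Rpower_1_l a : Rpower 1 a = 1.
Proof. by rewrite /Rpower ln_1 Rmult_0_r exp_0. Qed.

(** A discrete substitute for comparing with the integral of x^(u-1): the right side telescopes in
    [power_sum_le]. *)
Lemma Rpower_concave_step x u : 1 < x -> 0 < u <= 1 ->
  Rpower x (- (1 - u)) <= (Rpower x u - Rpower (x - 1) u) / u.
Proof.
move=> x_gt1 u01; have ix_gt0 : 0 < / x by apply: Rinv_0_lt_compat; lra.
have Et : (x - 1) * / x = 1 - / x by field; lra.
have t_gt0 : 0 < (x - 1) * / x by apply: Rmult_lt_0_compat; lra.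
have -> : - (1 - u) = u + - (1) by lra.
rewrite Rpower_plus Rpower_Ropp Rpower_1; last lra.
have -> : Rpower (x - 1) u = Rpower x u * Rpower ((x - 1) * / x) u.
  rewrite Rpower_mult_distr //; last lra.
  by congr Rpower; field; lra.
have xu_gt0 := Rpower_gt0 x u.
have := Rmult_le_compat_l _ _ _ (Rlt_le _ _ xu_gt0) (Rpower_le_affine _ _ t_gt0 u01).
rewrite Et => le_t.
apply: (Rmult_le_reg_r u); first lra.
by rewrite /Rdiv [X in _ <= X]Rmult_assoc Rinv_l; [lra | lra].
Qed.

Lemma rsum_iotaS m n (f : nat -> R) :
  \rsum_(i <- iota m n.+1) f i = \rsum_(i <- iota m n) f i + f (m + n)%N.
Proof. by rewrite -addn1 iotaD big_cat big_seq1. Qed.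

Lemma power_sum_le u d : 0 < u <= 1 ->
  \rsum_(j <- iota 1 d) Rpower (INR j) (- (1 - u)) <= Rpower (INR d) u / u.
Proof.
move=> u01; have iu_gt0 := Rinv_0_lt_compat u (proj1 u01).
case: d => [|d].
  by rewrite big_nil; apply: Rlt_le; apply: Rmult_lt_0_compat => //; apply: Rpower_gt0.
elim: d => [|d IHd].
  rewrite big_seq1 !Rpower_1_l /Rdiv Rmult_1_l -{1}Rinv_1.
  by apply: Rinv_le_contravar; lra.
rewrite rsum_iotaS add1n.
have := Rpower_concave_step (INR d.+2) u (ltINR 1 d.+2 isT) u01.
have -> : INR d.+2 - 1 = INR d.+1 by rewrite (S_INR d.+1); lra.
rewrite /Rdiv in IHd *; lra.
Qed.

(** The product of distinct prime divisors of N divides N. This serves Chebyshev's bound, the number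
    of primes of given rank, and the number of large prime factors. *)
Lemma prod_primes_le (B : R) (s : seq nat) N : uniq s -> (0 < N)%N -> 0 <= B ->
  (forall p, p \in s -> prime p /\ (p %| N)%N /\ B <= INR p) ->
  B ^ size s <= INR N.
Proof.
move=> + + B_ge0; elim: s N => [|p s IHs] N /=; first by move=> _ N_gt0 _; apply: INR_ge1.
move=> /andP[p_s s_uniq] N_gt0 sN.
have [p_pr [/dvdnP[M NE] B_p]] := sN p (mem_head _ _).
rewrite NE INRM Rmult_comm; apply: Rmult_le_compat => //; first exact: pow_le.
apply: IHs => //; first by move: N_gt0; rewrite NE; case: (M).
move=> q q_s; have [|q_pr [q_N B_q]] := sN q; first by rewrite inE q_s orbT.
split=> //; split=> //; move: q_N; rewrite NE Gauss_dvdl // prime_coprime //.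
rewrite dvdn_prime2 //; apply: contraNneq p_s => <- //.
Qed.

(** * Chebyshev's bound and sums over primes *)

Lemma bin_le_exp n m : ('C(n, m) <= 2 ^ n)%N.
Proof.
elim: n m => [|n IHn] [|m]; rewrite ?bin0 ?bin0n ?expn_gt0 //.
by rewrite binS expnS mul2n -addnn leq_add.
Qed.

Lemma prime_dvdn_fact p n : prime p -> (p %| n`!)%N -> (p <= n)%N.
Proof.
move=> p_pr; elim: n => [|n IHn]; first by rewrite fact0 dvdn1 => /eqP p1; rewrite p1 in p_pr.
by rewrite factS Euclid_dvdM // => /orP[/dvdn_leq->//|/IHn/leqW].
Qed.

Lemma prime_dvdn_central_bin p n : prime p -> (n < p <= n.*2)%N -> (p %| 'C(n.*2, n))%N.
Proof.
move=> p_pr /andP[n_p p_2n].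
have := bin_fact (leq_addl n n); rewrite addnn -{2}addnn addnK => Eb.
have : (p %| (n.*2)`!)%N by rewrite dvdn_fact // prime_gt0.
rewrite -Eb !Euclid_dvdM // orbb => /orP[//|/prime_dvdn_fact-/(_ p_pr)].
by rewrite leqNgt n_p.
Qed.

(* Chebyshev's bound, from [2 ^ (i * #s) <= 'C(2 ^ i.+1, 2 ^ i) <= 2 ^ 2 ^ i.+1]. *)
Lemma dyadic_primes i (s : seq nat) : uniq s ->
  (forall p, p \in s -> prime p /\ (2 ^ i < p <= 2 ^ i.+1)%N) ->
  (i * size s <= 2 ^ i.+1)%N.
Proof.
move=> s_uniq s_pr; rewrite -(leq_exp2l (m := 2)) // expnM.
have H2 : (2 ^ i.+1 = (2 ^ i).*2)%N by rewrite expnS mul2n.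
apply: leq_trans (bin_le_exp (2 ^ i.+1) (2 ^ i)); apply/leP/INR_le; rewrite INRX.
apply: prod_primes_le => //; [|exact: pos_INR|].
  by rewrite bin_gt0 leq_exp2l.
move=> p /s_pr[p_pr p_i]; split=> //; split; last by apply: leINR; case/andP: p_i => /ltnW.
by rewrite H2 prime_dvdn_central_bin // -H2.
Qed.

(** Dyadic decomposition: by [dyadic_primes] the primes in (2^i, 2^(i+1)] contribute at most 2 *
    2^(i v) / i. Bounding 1 / i by i^-(1 - eta) trades a logarithm for I^eta / eta, so that
    [power_sum_le] applies again. *)
Lemma prime_sum_le I v eta (s : seq nat) : 0 < v < 1 -> 0 < eta <= 1 -> uniq s ->
  (forall q, q \in s -> prime q /\ (q <= 2 ^ I)%N) ->
  \rsum_(q <- s) Rpower (INR q) (- (1 - v)) <=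
  1 + 2 * Rpower (INR (2 ^ I)%N) v * (Rpower (INR I) eta / eta).
Proof.
move=> v01 eta01 s_uniq s_I.
pose cl q := (up_log 2 q).-1.
have clP q : q \in s -> (2 ^ cl q < q <= 2 ^ (cl q).+1)%N.
  move=> /s_I[q_pr _]; have q_gt1 := prime_gt1 q_pr.
  by have := up_log_bounds (isT : 1 < 2)%N q_gt1; rewrite /cl; case: up_log => [|k] //=; lia.
have cl_I q : q \in s -> (cl q < I)%N.
  move=> q_s; have [_ q_I] := s_I q q_s; case/andP: (clP q q_s) => q_gt _.
  by rewrite -(ltn_exp2l (m := 2)) //; apply: leq_trans q_gt q_I.
case: I s_I cl_I => [|I] s_I cl_I.
  case: s s_uniq s_I cl_I clP => [|q s] s_uniq s_I cl_I clP; last by have := cl_I q (mem_head _ _).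
  rewrite big_nil; have := Rpower_gt0 (INR (2 ^ 0)%N) v; have := Rpower_gt0 (INR 0) eta.
  have := Rinv_0_lt_compat eta; move=> ? ? ?.
  have : 0 < 2 * Rpower (INR (2 ^ 0)%N) v * (Rpower (INR 0) eta / eta); last lra.
  apply: Rmult_lt_0_compat; first lra; apply: Rmult_lt_0_compat; tauto.
rewrite (rsum_fiber _ _ _ (iota 0 I.+1) cl) ?iota_uniq //; last first.
  by move=> q q_s; rewrite mem_iota cl_I.
(* Class 0 contains at most the prime 2 and accounts for the summand 1. *)
rewrite /= big_cons; apply: Rplus_le_compat.
  rewrite -big_filter.
  apply: (Rle_trans _ (\rsum_(b <- [:: 2%N]) Rpower (INR b) (- (1 - v)))).
    apply: rsum_sub; first exact: filter_uniq.
      move=> q; rewrite mem_filter inE => /andP[/eqP cl0 q_s].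
      by have := clP q q_s; rewrite cl0; lia.
    by move=> *; apply: Rlt_le; apply: Rpower_gt0.
  by rewrite big_seq1; apply: Rlt_le; apply: Rpower_lt1; [apply: (ltINR 1) | lra].
set X := INR (2 ^ I.+1)%N.
apply: (Rle_trans _ (\rsum_(i <- iota 1 I) (2 * Rpower X v * Rpower (INR i) (- (1 - eta))))).
  apply: rsum_le => i; rewrite mem_iota => /andP[i_gt0 i_I] _.
  rewrite -big_filter; set t := [seq q <- s | _].
  have tP q : q \in t -> prime q /\ (2 ^ i < q <= 2 ^ i.+1)%N.
    by rewrite mem_filter => /andP[/eqP <- q_s]; split; [case: (s_I q q_s) | apply: clP].
  apply: (Rle_trans _ (\rsum_(q <- t) Rpower (INR (2 ^ i)%N) (- (1 - v)))).
    apply: rsum_le => q /tP[_ /andP[q_gt _]] _; apply: Rpower_neg_le; last lra.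
    by split; [apply: INR_gt0; rewrite expn_gt0 | apply: leINR; apply: ltnW].
  rewrite rsum_const.
  have /leINR := dyadic_primes i t (filter_uniq _ s_uniq) tP.
  rewrite expnS !INRM => le_t.
  set Y := INR (2 ^ i)%N in le_t *.
  have Y_gt0 : 0 < Y by apply: INR_gt0; rewrite expn_gt0.
  have Yv : Rpower Y (- (1 - v)) * Y = Rpower Y v.
    by rewrite -{2}(Rpower_1 Y) // -Rpower_plus; congr Rpower; lra.
  have YX : Rpower Y v <= Rpower X v.
    by apply: Rpower_le_base; [split=> //; apply: leINR; rewrite leq_exp2l //; lia | lra].
  have i_ge1 := INR_ge1 i i_gt0.
  have ii : / INR i <= Rpower (INR i) (- (1 - eta)).
    by rewrite -{1}(Rpower_1 (INR i)) -?Rpower_Ropp; [apply: Rle_Rpower; lra | lra].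
  have Y'_gt0 := Rpower_gt0 Y (- (1 - v)).
  have i_inv : 0 < / INR i by apply: Rinv_0_lt_compat; lra.
  apply: (Rle_trans _ (2 * Y * / INR i * Rpower Y (- (1 - v)))).
    apply: Rmult_le_compat_r; first exact: Rlt_le.
    apply: (Rmult_le_reg_l (INR i)); first lra.
    have -> : INR i * (2 * Y * / INR i) = 2 * Y by field; lra.
    exact: le_t.
  have -> : 2 * Y * / INR i * Rpower Y (- (1 - v)) = 2 * Rpower Y v * / INR i by rewrite -Yv; lra.
  apply: Rmult_le_compat => //; [|exact: Rlt_le|].
    by have := Rpower_gt0 Y v; lra.
  lra.
rewrite rsum_scale; apply: Rmult_le_compat_l; first by have := Rpower_gt0 X v; lra.
apply: Rle_trans (power_sum_le eta I eta01) _.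
apply: Rmult_le_compat_r; first by apply: Rlt_le; apply: Rinv_0_lt_compat; lra.
change (Rpower (INR I) eta <= Rpower (INR I.+1) eta).
case: (I) => [|J]; first by rewrite Rpower_0_l Rpower_1_l; lra.
apply: Rpower_le_base; last lra.
by split; [apply: INR_gt0 | apply: leINR].
Qed.

(** * Integers whose prime factors have rank dividing [m] *)

(** Rankin's trick: each b <= y is counted with weight (y / b)^a >= 1. *)
Lemma rankin_bound (Q s : seq nat) (a y : R) (h : nat -> R) :
  0 < a -> uniq Q -> all prime Q ->
  (forall q, q \in Q -> / (1 - Rpower (INR q) (- a)) <= exp (h q)) ->
  uniq s -> (forall b, b \in s -> (0 < b)%N /\ {subset primes b <= Q} /\ INR b <= y) ->
  INR (size s) <= Rpower y a * exp (\rsum_(q <- Q) h q).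
Proof.
move=> a_gt0 Q_uniq Q_pr h_bd s_uniq s_Q.
rewrite -[INR _]Rmult_1_r -rsum_const.
apply: (Rle_trans _ (\rsum_(b <- s) (Rpower y a * Rpower (INR b) (- a)))).
  apply: rsum_le => b /s_Q[b_gt0 [_ b_y]] _.
  rewrite Rpower_Ropp -(Rinv_r (Rpower (INR b) a)); last by have := Rpower_gt0 (INR b) a; lra.
  apply: Rmult_le_compat_r; first by apply: Rlt_le; apply: Rinv_0_lt_compat; apply: Rpower_gt0.
  by apply: Rpower_le_base; [split=> //; apply: INR_gt0 | lra].
rewrite rsum_scale; apply: Rmult_le_compat_l; first by apply: Rlt_le; apply: Rpower_gt0.
by apply: euler_product_bound => // b /s_Q[? []].
Qed.

Lemma euler_factor_le q a : (1 < q)%N -> / 2 <= a ->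
  / (1 - Rpower (INR q) (- a)) <= exp (4 * Rpower (INR q) (- a)).
Proof.
move=> q_gt1 a_ge; have q_ge2 : 2 <= INR q by exact: (leINR 2).
set t := Rpower (INR q) (- a).
have t_gt0 : 0 < t by exact: Rpower_gt0.
(* The constant 4 comes from here: (1 - t) (1 + 4 t) >= 1 for 0 <= t <= 3/4, and 2^(-1/2) < 3/4. *)
have t_le : t <= 3 / 4.
  apply: (Rle_trans _ (Rpower 2 (- / 2))).
    apply: (Rle_trans _ (Rpower 2 (- a))); first by apply: Rpower_neg_le; lra.
    by apply: Rle_Rpower; lra.
  have E : Rpower 2 (- / 2) * Rpower 2 (- / 2) = / 2.
    by rewrite -Rpower_plus (_ : _ + _ = - (1)) ?Rpower_Ropp ?Rpower_1; lra.
  by have := Rpower_gt0 2 (- / 2); nra.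
apply: (Rle_trans _ (1 + 4 * t)); last exact: exp_ineq1_le.
apply: (Rmult_le_reg_l (1 - t)); first lra.
by rewrite Rinv_r; nra.
Qed.

(** The product of these primes divides [fib d], which is less than 2^d, and each is at least 2. *)
Lemma rank_fiber_size d (s : seq nat) : (0 < d)%N -> uniq s ->
  (forall p, p \in s -> prime p /\ rank p = d) -> (size s <= d)%N.
Proof.
move=> d_gt0 s_uniq s_d; rewrite leqNgt; apply/negP => lt_ds.
have : 2 ^ size s <= INR (fib d).
  apply: prod_primes_le => //; [exact: fib_gt0 | lra | move=> p /s_d[p_pr rp]].
  by split=> //; split; [rewrite -dvdn_rank rp | apply: (leINR 2); apply: prime_gt1].
have -> : 2 ^ size s = INR (2 ^ size s)%N by rewrite INRX.
move/INR_le/leP; apply/negP; rewrite -ltnNge.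
by apply: leq_trans (fib_lt_exp d) _; rewrite leq_exp2l // ltnW.
Qed.

(** A prime of rank d is 1 or -1 modulo d; the middle candidate j d is there for p = 5, whose rank
    is 5. *)
Lemma rank_fiber_near d p : (1 < d)%N -> prime p -> rank p = d -> (p <= d ^ 2)%N ->
  exists2 j, j \in iota 1 d & p \in [:: (j * d).-1; j * d; (j * d).+1]%N.
Proof.
move=> d_gt1 p_pr rp p_le; have p_gt1 := prime_gt1 p_pr.
have [p5|p_n5] := eqVneq p 5%N.
  exists 1%N; first by rewrite mem_iota /= add1n ltnS (ltnW d_gt1).
  by rewrite mul1n -rp p5 rank5 !inE eqxx orbT.
case/orP: (rank_prime_dvd p p_pr p_n5); rewrite rp => /dvdnP[j jE]; exists j.
- rewrite mem_iota add1n ltnS; apply/andP; split.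
    by move: jE; case: (j) => //; lia.
  by rewrite -(leq_pmul2r (ltnW d_gt1)) -jE; apply: leq_trans (leq_pred _) p_le.
- by rewrite -jE !inE prednK ?eqxx ?orbT // ltnW.
- rewrite mem_iota add1n ltnS; apply/andP; split; first by move: jE; case: (j).
  rewrite -ltnS -(ltn_pmul2r (ltnW d_gt1)) -jE mulSn; apply: (leq_ltn_trans (n := (d ^ 2).+1)) => //.
  by rewrite -addn2 addnC leq_add2r.
- by rewrite -jE !inE eqxx.
Qed.

(** Split at d^2. Below, at most three candidates lie near each j d with j <= d; above, at most d
    primes contribute at most d^(-2(1-u)) each. The constant is 7 = 3 * 2 + 1. *)
Lemma rank_fiber_sum u d (s : seq nat) : 0 < u <= 1 / 4 -> (0 < d)%N -> uniq s ->
  (forall p, p \in s -> prime p /\ rank p = d) ->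
  \rsum_(p <- s) Rpower (INR p) (- (1 - u)) <= 7 / u * Rpower (INR d) (- (1 - 2 * u)).
Proof.
move=> u_bd d_gt0 s_uniq s_d; have iu_gt0 : 0 < / u by apply: Rinv_0_lt_compat; lra.
have iu_ge4 : 4 <= / u.
  by apply: (Rmult_le_reg_l u); rewrite ?Rinv_r; lra.
have d_R : 1 <= INR d by exact: INR_ge1.
set D := Rpower (INR d) (- (1 - 2 * u)); have D_gt0 : 0 < D by exact: Rpower_gt0.
(* No prime has rank 1, since F_1 = 1. *)
have [d_le1|d_gt1] := leqP d 1.
  have d1 : d = 1%N by lia.
  case: s s_uniq s_d => [|p s] _ s_d.
    by rewrite big_nil; apply: Rlt_le; apply: Rmult_lt_0_compat => //; lra.
  have [p_pr rp] := s_d p (mem_head _ _).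
  have := dvdn_rank p d; rewrite {1}rp dvdnn d1 dvdn1 => /esym/eqP p1.
  by rewrite p1 in p_pr.
rewrite (bigID (fun p => p <= d ^ 2)%N) /=.
have Ed : Rpower (INR d) (- (1 - u)) * Rpower (INR d) u = D.
  by rewrite -Rpower_plus; congr Rpower; lra.
have HA : \rsum_(p <- s | (p <= d ^ 2)%N) Rpower (INR p) (- (1 - u)) <= 6 * D / u.
  rewrite -big_filter.
  apply: (Rle_trans _ (\rsum_(p <- flatten [seq [:: (j * d).-1; j * d; (j * d).+1]%N | j <- iota 1 d])
     Rpower (INR p) (- (1 - u)))).
    apply: rsum_sub; first exact: filter_uniq.
      move=> p; rewrite mem_filter => /andP[p_le p_s]; have [p_pr rp] := s_d p p_s.
      have [j j_d p_j] := rank_fiber_near _ _ d_gt1 p_pr rp p_le.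
      by apply/flatten_mapP; exists j.
    by move=> *; apply: Rlt_le; apply: Rpower_gt0.
  rewrite big_flatten big_map /=.
  apply: (Rle_trans _ (\rsum_(j <- iota 1 d) (6 * Rpower (INR d) (- (1 - u)) * Rpower (INR j) (- (1 - u))))).
    apply: rsum_le => j; rewrite mem_iota => /andP[j_gt0 j_d] _.
    rewrite !big_cons big_nil.
    have j_R := INR_ge1 _ j_gt0.
    (* The neighbours of j d are at least j d / 2, which costs a factor at most 2. *)
    have near a : (0 < a)%N -> (j * d <= 2 * a)%N ->
        Rpower (INR a) (- (1 - u)) <= 2 * (Rpower (INR d) (- (1 - u)) * Rpower (INR j) (- (1 - u))).
      move=> a_gt0 le_a; rewrite Rpower_mult_distr; try lra.
      apply: (Rle_trans _ (Rpower (/ 2 * (INR d * INR j)) (- (1 - u)))).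
        apply: Rpower_neg_le; last lra; split; first nra.
        by have := leINR _ _ le_a; rewrite !INRM /=; lra.
      rewrite -Rpower_mult_distr; [|lra|nra].
      apply: Rmult_le_compat_r; first by apply: Rlt_le; apply: Rpower_gt0.
      rewrite /Rpower ln_Rinv; last lra.
      rewrite (_ : _ * - ln 2 = (1 - u) * ln 2); last lra.
      rewrite -[X in _ <= X](Rpower_1 2); last lra.
      by apply: exp_le; have := ln_lt_2; nra.
    have jd_gt1 : (1 < j * d)%N by apply: leq_trans d_gt1 _; rewrite leq_pmull.
    have N1 := near (j * d).-1 (ltac:(lia)) (ltac:(lia)).
    have N2 := near (j * d)%N (ltac:(lia)) (ltac:(lia)).
    have N3 := near (j * d).+1 (ltac:(lia)) (ltac:(lia)).
    lra.
  rewrite rsum_scale.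
  have PS := power_sum_le u d (ltac:(lra)).
  have A_ge0 : 0 <= 6 * Rpower (INR d) (- (1 - u)).
    by have := Rpower_gt0 (INR d) (- (1 - u)); lra.
  apply: Rle_trans (Rmult_le_compat_l _ _ _ A_ge0 PS) _.
  by rewrite -Ed /Rdiv; lra.
have HB : \rsum_(p <- s | ~~ (p <= d ^ 2)%N) Rpower (INR p) (- (1 - u)) <= D.
  rewrite -big_filter; set s' := [seq p <- s | _].
  apply: (Rle_trans _ (\rsum_(p <- s') Rpower (INR d) (- (2 * (1 - u))))).
    apply: rsum_le => p; rewrite mem_filter -ltnNge => /andP[p_gt _] _.
    rewrite (_ : - (2 * (1 - u)) = 2 * - (1 - u)); last lra.
    rewrite -Rpower_mult (_ : Rpower (INR d) 2 = INR (d ^ 2)%N); last first.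
      by rewrite INRX -Rpower_pow //; lra.
    apply: Rpower_neg_le; last lra.
    by split; [apply: INR_gt0; rewrite expn_gt0 d_gt0 | apply: leINR; apply: ltnW].
  rewrite rsum_const.
  have /leINR size_s' : (size s' <= d)%N.
    apply: rank_fiber_size => //; first exact: filter_uniq.
    by move=> p; rewrite mem_filter => /andP[_ /s_d].
  apply: (Rle_trans _ (INR d * Rpower (INR d) (- (2 * (1 - u))))).
    by apply: Rmult_le_compat_r => //; apply: Rlt_le; apply: Rpower_gt0.
  rewrite -{1}(Rpower_1 (INR d)); last lra.
  by rewrite -Rpower_plus; apply: Req_le; congr Rpower; lra.
rewrite /Rdiv in HA *.
have : D <= D * / u by nra.
lra.
Qed.

(** Grouping primes by rank leaves a sum over the divisors of m, bounded by its Euler product; u <=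
    1/4 keeps the exponent 1 - 2 u at least 1/2, as [euler_factor_le] requires. *)
Lemma rank_dvd_sum u m (s : seq nat) : 0 < u <= 1 / 4 -> (0 < m)%N -> uniq s ->
  (forall p, p \in s -> prime p /\ (rank p %| m)%N) ->
  \rsum_(p <- s) Rpower (INR p) (- (1 - u)) <=
  7 / u * exp (4 * \rsum_(q <- primes m) Rpower (INR q) (- (1 - 2 * u))).
Proof.
move=> u_bd m_gt0 s_uniq s_m.
have iu_gt0 : 0 < / u by apply: Rinv_0_lt_compat; lra.
rewrite (rsum_fiber _ _ _ (divisors m) rank) ?divisors_uniq //; last first.
  by move=> p /s_m[_]; rewrite dvdn_divisors.
apply: (Rle_trans _ (\rsum_(d <- divisors m) (7 / u * Rpower (INR d) (- (1 - 2 * u))))).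
  apply: rsum_le => d; rewrite -dvdn_divisors // => d_m _; rewrite -big_filter.
  apply: rank_fiber_sum => //; [exact: dvdn_gt0 d_m | exact: filter_uniq |].
  by move=> p; rewrite mem_filter => /andP[/eqP rp /s_m[]].
rewrite rsum_scale; apply: Rmult_le_compat_l; first by apply: Rlt_le; rewrite /Rdiv; lra.
rewrite -rsum_scale; apply: euler_product_bound.
- lra.
- exact: primes_uniq.
- by apply/allP => q; rewrite mem_primes => /andP[].
- move=> q; rewrite mem_primes => /andP[q_pr _].
  by apply: euler_factor_le; [apply: prime_gt1 | lra].
- exact: divisors_uniq.
move=> d; rewrite -dvdn_divisors // => d_m; split; first exact: dvdn_gt0 d_m.
move=> q; rewrite !mem_primes m_gt0 => /and3P[-> _ q_d] /=; exact: dvdn_trans d_m.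
Qed.

(** Each prime factor of k has rank dividing m, so Rankin's method with exponent 1 - u applies to
    the set Q of these primes. *)
Lemma rank_dvd_count u m y (s : seq nat) : 0 < u <= 1 / 4 -> (0 < m)%N -> uniq s ->
  (forall k, k \in s -> (0 < k)%N /\ (rank k %| m)%N /\ INR k <= y) ->
  INR (size s) <= Rpower y (1 - u) *
    exp (28 / u * exp (4 * \rsum_(q <- primes m) Rpower (INR q) (- (1 - 2 * u)))).
Proof.
move=> u_bd m_gt0 s_uniq s_m.
pose Q := undup (flatten [seq primes k | k <- s]).
have QP p : p \in Q -> prime p /\ (rank p %| m)%N.
  rewrite mem_undup => /flatten_mapP[k /s_m[k_gt0 [rk _]]].
  rewrite mem_primes => /and3P[p_pr _ p_k]; split=> //.
  exact: dvdn_trans (rank_dvd _ _ p_k) rk.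
apply: Rle_trans (rankin_bound Q s (1 - u) y (fun q => 4 * Rpower (INR q) (- (1 - u))) _ _ _ _ _ _) _ => //.
- lra.
- exact: undup_uniq.
- by apply/allP => p /QP[].
- by move=> q /QP[q_pr _]; apply: euler_factor_le; [apply: prime_gt1 | lra].
- move=> k k_s; have [k_gt0 [_ k_y]] := s_m k k_s; split=> //; split=> // p p_k.
  by rewrite mem_undup; apply/flatten_mapP; exists k.
apply: Rmult_le_compat_l; first by apply: Rlt_le; apply: Rpower_gt0.
apply: exp_le; rewrite rsum_scale.
have H := rank_dvd_sum u m Q u_bd m_gt0 (undup_uniq _) QP.
apply: Rle_trans (Rmult_le_compat_l 4 _ _ ltac:(lra) H) _.
by rewrite /Rdiv; lra.
Qed.

(** * Integers with a given quotient [n / rank n] *)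

Definition nat_floor (r : R) : nat := Z.to_nat (Int_part r).

Lemma nat_floor_le r : 0 <= r -> INR (nat_floor r) <= r.
Proof.
move=> r_ge0; have [le_r gt_r] := base_Int_part r.
rewrite /nat_floor INR_IZR_INZ Z2Nat.id //.
have /lt_IZR : -1 < IZR (Int_part r) by lra.
by lia.
Qed.

Lemma le_nat_floor n r : INR n <= r -> (n <= nat_floor r)%N.
Proof.
move=> n_r; have [le_r gt_r] := base_Int_part r.
have /lt_IZR : IZR (Z.of_nat n) < IZR (Z.succ (Int_part r)).
  by rewrite succ_IZR -INR_IZR_INZ; lra.
by rewrite /nat_floor; lia.
Qed.

Lemma size_le_bound r (s : seq nat) : 0 <= r -> uniq s ->
  (forall n, n \in s -> (0 < n)%N /\ INR n <= r) -> INR (size s) <= r.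
Proof.
move=> r_ge0 s_uniq s_r; apply: Rle_trans (nat_floor_le r r_ge0).
apply: leINR; rewrite -[X in (_ <= X)%N](size_iota 1); apply: uniq_leq_size => // n /s_r[n_gt0 n_r].
by rewrite mem_iota n_gt0 add1n ltnS le_nat_floor.
Qed.

Lemma exp_INR n a : exp a ^ n = exp (INR n * a).
Proof. by rewrite -Rpower_pow ?/Rpower ?ln_exp //; apply: exp_pos. Qed.

Lemma prime_factors_size (N : nat) (a c : R) (s : seq nat) : (0 < N)%N -> INR N <= exp c -> uniq s ->
  {subset s <= primes N} -> (forall p, p \in s -> exp a <= INR p) -> INR (size s) * a <= c.
Proof.
move=> N_gt0 N_c s_uniq s_N s_a.
have : exp a ^ size s <= INR N.
  apply: prod_primes_le => //; first exact: Rlt_le (exp_pos _).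
  by move=> p /[dup] /s_N; rewrite mem_primes => /and3P[? _ ?] /s_a.
rewrite exp_INR => le_N; apply: Rnot_lt_le => /exp_increasing; lra.
Qed.

Lemma two_le_exp1 : 2 <= exp 1.
Proof. by have := exp_ineq1_le 1; lra. Qed.

(** The factor is in fact at most 2 Y; the cruder exponential is affordable because it is used only
    for q <= exp (Y / 2). *)
Lemma smooth_factor_small q Y : (1 < q)%N -> 2 <= Y ->
  / (1 - Rpower (INR q) (- (2 / Y))) <= exp (2 * Y).
Proof.
move=> q_gt1 Y_ge2; have iY_gt0 : 0 < / Y by apply: Rinv_0_lt_compat; lra.
have iY_le : / Y <= / 2 by apply: Rinv_le_contravar; lra.
set t := 2 / Y * ln 2.
have ln2_lt1 : ln 2 <= 1 by have := ln_le_sub1 2; lra.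
have t_gt : / Y <= t by rewrite /t /Rdiv; have := ln_lt_2; nra.
have t_le : t <= 1 by rewrite /t /Rdiv; nra.
have le_t : Rpower (INR q) (- (2 / Y)) <= / (1 + t).
  apply: (Rle_trans _ (Rpower 2 (- (2 / Y)))).
    by apply: Rpower_neg_le; [split; [lra | exact: (leINR 2)] | rewrite /Rdiv; lra].
  rewrite Rpower_Ropp; apply: Rinv_le_contravar; first lra.
  exact: exp_ineq1_le.
have E : / (1 + t) = 1 - t * / (1 + t) by field; lra.
have it_ge : / 2 <= / (1 + t) by apply: Rinv_le_contravar; lra.
have H : / (2 * Y) <= 1 - Rpower (INR q) (- (2 / Y)).
  rewrite Rinv_mult; apply: (Rle_trans _ (t * / (1 + t))); last lra.
  nra.
apply: (Rle_trans _ (2 * Y)); last by have := exp_ineq1_le (2 * Y); lra.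
rewrite -(Rinv_inv (2 * Y)); apply: Rinv_le_contravar => //.
by apply: Rinv_0_lt_compat; lra.
Qed.

Lemma smooth_factor_large q Y : 0 < Y -> exp (Y / 2) <= INR q ->
  / (1 - Rpower (INR q) (- (2 / Y))) <= exp 1.
Proof.
move=> Y_gt0 q_Y; have iY_gt0 : 0 < / Y by apply: Rinv_0_lt_compat; lra.
have : Rpower (INR q) (- (2 / Y)) <= / 2.
  apply: (Rle_trans _ (Rpower (exp (Y / 2)) (- (2 / Y)))).
    by apply: Rpower_neg_le; [split=> //; apply: exp_pos | rewrite /Rdiv; lra].
  rewrite /Rpower ln_exp (_ : - (2 / Y) * (Y / 2) = - 1); last by field; lra.
  by rewrite exp_Ropp; apply: Rinv_le_contravar; [lra | exact: two_le_exp1].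
move=> le_h; apply: Rle_trans two_le_exp1.
by rewrite -[X in _ <= X]Rinv_inv; apply: Rinv_le_contravar; lra.
Qed.

(* Rankin's method with exponent [2 / Y], [Y = ln (ln x)], splitting the primes
   at [sqrt (ln x)]. *)
Lemma smooth_count X Y k (s : seq nat) : X = exp Y -> 2 <= Y -> (0 < k)%N -> INR k <= exp X ->
  uniq s -> (forall b, b \in s -> (0 < b)%N /\ {subset primes b <= primes (30 * k)} /\ INR b <= exp X) ->
  INR (size s) <= exp (2 * X / Y + (2 * Y * exp (Y / 2) + 2 * (X + 30) / Y)).
Proof.
move=> XE Y_ge2 k_gt0 k_x s_uniq s_k.
have iY_gt0 : 0 < / Y by apply: Rinv_0_lt_compat; lra.
pose a q := if (q <= nat_floor (exp (Y / 2)))%N then 2 * Y else 1.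
have large q : (q <= nat_floor (exp (Y / 2)))%N = false -> exp (Y / 2) <= INR q.
  move=> /negbT q_Y; apply: Rnot_lt_le => /Rlt_le/le_nat_floor; exact/negP.
have N_gt0 : (0 < 30 * k)%N by rewrite muln_gt0.
apply: Rle_trans (rankin_bound (primes (30 * k)) s (2 / Y) (exp X) a _ _ _ _ _ _) _ => //.
- by rewrite /Rdiv; lra.
- exact: primes_uniq.
- by apply/allP => q; rewrite mem_primes => /andP[].
- move=> q; rewrite mem_primes => /andP[/prime_gt1 q_gt1 _]; rewrite /a.
  case: ifP => [_|/large]; first exact: smooth_factor_small.
  by apply: smooth_factor_large; lra.
rewrite /Rpower ln_exp -exp_plus; apply: exp_le.
apply: Rplus_le_compat; first by apply: Req_le; rewrite /Rdiv; lra.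
rewrite (bigID (fun q => q <= nat_floor (exp (Y / 2)))%N) /=.
apply: Rplus_le_compat.
  rewrite -big_filter (eq_big_seq (fun=> 2 * Y)) => [|q]; last first.
    by rewrite mem_filter /a => /andP[->].
  rewrite rsum_const Rmult_comm; apply: Rmult_le_compat_l; first lra.
  apply: size_le_bound; [exact: Rlt_le (exp_pos _) | exact/filter_uniq/primes_uniq |].
  move=> q; rewrite mem_filter mem_primes => /andP[q_le /andP[/prime_gt0 q_gt0 _]]; split=> //.
  by apply: Rle_trans (leINR _ _ q_le) (nat_floor_le _ (Rlt_le _ _ (exp_pos _))).
rewrite -big_filter (eq_big_seq (fun=> 1)) => [|q]; last first.
  by rewrite mem_filter /a => /andP[/negPf->].
rewrite rsum_const Rmult_1_r.
(* There are few large prime factors: each is at least exp (Y / 2), while 30 k <= exp (X + 30). *)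
have : INR (size [seq q <- primes (30 * k) | ~~ (q <= nat_floor (exp (Y / 2)))%N]) * (Y / 2) <= X + 30.
  apply: (prime_factors_size (30 * k)) => //.
  - rewrite INRM exp_plus Rmult_comm; apply: Rmult_le_compat => //; try exact: pos_INR.
    by have := exp_ineq1_le 30; rewrite (_ : INR 30 = 30) /=; lra.
  - exact/filter_uniq/primes_uniq.
  - by move=> q; rewrite mem_filter => /andP[].
  - by move=> q; rewrite mem_filter => /andP[/negPf/large].
move=> H; apply: (Rmult_le_reg_r (Y / 2)); first lra.
by apply: Rle_trans H _; apply: Req_le; field; lra.
Qed.

(** By [rank_quotient_part], n is determined by its part composed of primes dividing 30 k, and
    [smooth_count] counts these parts. *)
Lemma rank_quotient_count X Y k (s : seq nat) : X = exp Y -> 2 <= Y ->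
  INR k <= exp X -> uniq s ->
  (forall n, n \in s -> (0 < n)%N /\ n = (k * rank n)%N /\ INR n <= exp X) ->
  INR (size s) <= exp (2 * X / Y + (2 * Y * exp (Y / 2) + 2 * (X + 30) / Y)).
Proof.
move=> XE Y_ge2 k_x s_uniq s_k.
have [k0|k_gt0] := posnP k.
  case: s s_uniq s_k => [|n s] _ s_k; first by apply: Rlt_le; apply: exp_pos.
  by have [n_gt0 [nE _]] := s_k n (mem_head _ _); rewrite nE k0 in n_gt0.
pose pi : nat_pred := \pi((30 * k)%N).
rewrite -(size_map (fun n => (n`_pi)%N) s); apply: (smooth_count X Y k) => //.
  rewrite map_inj_in_uniq // => n n' n_s n'_s eq_part.
  have [n_gt0 [nE _]] := s_k n n_s; have [n'_gt0 [n'E _]] := s_k n' n'_s.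
  rewrite -(partnC pi n_gt0) -(partnC pi n'_gt0) eq_part.
  by rewrite (rank_quotient_part k n n').
move=> _ /mapP[n n_s ->]; have [n_gt0 [_ n_x]] := s_k n n_s.
split; first exact: part_gt0.
split; last by apply: Rle_trans n_x; apply: leINR; apply: dvdn_leq => //; apply: dvdn_part.
move=> q q_n; have : q \in \pi((n`_pi)%N) by [].
by rewrite pi_of_part // => /andP[].
Qed.

(** Split the primes at a power of 2 between X and 2 X. The small ones fall under [prime_sum_le]; of
    the large ones m <= exp X has at most 2 X, each contributing at most X^-(1 - v). *)
Lemma prime_divisors_sum X Y v eta m : X = exp Y -> 0 <= Y -> 0 < v < 1 -> 0 < eta <= 1 ->
  (0 < m)%N -> INR m <= exp X ->
  \rsum_(q <- primes m) Rpower (INR q) (- (1 - v)) <=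
  1 + 2 * Rpower (2 * X) v * (Rpower (1 + 2 * Y) eta / eta) + 2 * Rpower X v.
Proof.
move=> XE Y_ge0 v01 eta01 m_gt0 m_x.
have X_gt0 : 0 < X by rewrite XE; apply: exp_pos.
have ln2 := ln_lt_2.
have ie_gt0 : 0 < / eta by apply: Rinv_0_lt_compat; lra.
(* The integer part of the base-2 logarithm of X, so X <= 2^(J+1) <= 2 X. *)
set J := nat_floor (Y / ln 2).
have Yl_ge0 : 0 <= Y / ln 2 by apply: Rmult_le_pos => //; apply: Rlt_le; apply: Rinv_0_lt_compat; lra.
have Yl : Y / ln 2 * ln 2 = Y by field; lra.
have J_le : INR J <= Y / ln 2 by exact: nat_floor_le.
have J_ge : Y / ln 2 <= INR J.+1.
  by apply: Rnot_lt_le => /Rlt_le/le_nat_floor; rewrite -/J ltnn.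
have I_E : INR (2 ^ J.+1)%N = exp (INR J.+1 * ln 2).
  by rewrite INRX -exp_INR exp_ln //; lra.
have X_I : X <= INR (2 ^ J.+1)%N by rewrite I_E XE; apply: exp_le; nra.
have I_X : INR (2 ^ J.+1)%N <= 2 * X.
  rewrite I_E XE -{2}(exp_ln 2); last lra.
  by rewrite -exp_plus; apply: exp_le; rewrite S_INR; nra.
have J_Y : INR J.+1 <= 1 + 2 * Y by rewrite S_INR; nra.
rewrite (bigID (fun q => q <= 2 ^ J.+1)%N) /=; apply: Rplus_le_compat.
  rewrite -big_filter; set s := [seq q <- _ | _].
  have s_uniq : uniq s by exact/filter_uniq/primes_uniq.
  apply: Rle_trans (prime_sum_le J.+1 v eta s v01 eta01 s_uniq _) _.
    by move=> q; rewrite mem_filter mem_primes => /andP[? /andP[]].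
  apply: Rplus_le_compat_l; rewrite !Rmult_assoc; apply: Rmult_le_compat_l; first lra.
  have J_gt0 := INR_gt0 J.+1 isT.
  apply: Rmult_le_compat.
  - exact/Rlt_le/Rpower_gt0.
  - by apply: Rmult_le_pos; [exact/Rlt_le/Rpower_gt0 | lra].
  - by apply: Rpower_le_base; lra.
  - by apply: Rmult_le_compat_r; [lra | apply: Rpower_le_base; lra].
rewrite -big_filter; set s := [seq q <- _ | _].
have s_size : INR (size s) * ln 2 <= X.
  apply: (prime_factors_size m) => //; first exact/filter_uniq/primes_uniq.
    by move=> q; rewrite mem_filter => /andP[].
  move=> q; rewrite mem_filter mem_primes exp_ln; last lra.
  by move=> /andP[_ /andP[/prime_gt1 q_gt1 _]]; exact: (leINR 2).
have s_size2 : INR (size s) <= 2 * X.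
  by have := Rmult_le_compat_l _ _ _ (pos_INR (size s)) (Rlt_le _ _ ln2); lra.
apply: (Rle_trans _ (\rsum_(q <- s) Rpower X (- (1 - v)))).
  apply: rsum_le => q; rewrite mem_filter -ltnNge => /andP[q_gt _] _.
  apply: Rpower_neg_le; last lra; split=> //.
  by apply: Rle_trans X_I _; apply: leINR; apply: ltnW.
rewrite rsum_const.
have <- : X * Rpower X (- (1 - v)) = Rpower X v.
  by rewrite -{1}(Rpower_1 X) // -Rpower_plus; congr Rpower; lra.
rewrite -Rmult_assoc; apply: Rmult_le_compat_r; first exact/Rlt_le/Rpower_gt0.
exact: s_size2.
Qed.

(** * The counting function *)

Lemma A_size x : A x = size [seq n <- iota 1 (nat_floor x) | (rank n %| n)%N].
Proof.
have seqE m n : List.seq m n = iota m n by elim: n m => //= n IHn m; rewrite IHn.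
rewrite /A /A_count seqE -/(nat_floor x).
transitivity (size [seq n <- iota 1 (nat_floor x) | Nat.eqb (Nat.modulo (fib n) n) 0]).
  by elim: (iota _ _) => //= n s; case: Nat.eqb => //= ->.
congr size; apply: eq_in_filter => n; rewrite mem_iota => /andP[n_gt0 _].
rewrite dvdn_rank; apply/idP/idP.
  move=> /Nat.eqb_eq /Nat.Div0.mod_divides[c ->]; exact: dvdn_mulr.
move=> /dvdnP[c ->]; apply/Nat.eqb_eq; exact: Nat.Div0.mod_mul.
Qed.

(* [n = k * rank n] is counted by its quotient [k] when [k <= x ^ (1 - u)], and
   otherwise by its rank [m < x ^ u], where [n = m * k] with [rank k %| m]. *)
Lemma self_fib_count X Y u eta : X = exp Y -> 2 <= Y -> 0 < u <= 1 / 4 -> 0 < eta <= 1 ->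
  INR (A (exp X)) <= exp (X - u * X) *
    (exp (2 * X / Y + (2 * Y * exp (Y / 2) + 2 * (X + 30) / Y)) +
     exp (28 / u * exp (4 * (1 + 2 * Rpower (2 * X) (2 * u) *
        (Rpower (1 + 2 * Y) eta / eta) + 2 * Rpower X (2 * u)))) * (exp (u * u * X) / u)).
Proof.
move=> XE Y_ge2 u_bd eta01; rewrite A_size; set s := [seq n <- _ | _].
set b := exp (2 * X / Y + _); set P := exp (28 / u * _).
have X_gt0 : 0 < X by rewrite XE; apply: exp_pos.
have s_uniq : uniq s by exact/filter_uniq/iota_uniq.
have sP n : n \in s -> (0 < n)%N /\ n = (n %/ rank n * rank n)%N /\ INR n <= exp X.
  rewrite mem_filter mem_iota => /andP[rn /andP[n_gt0 n_x]]; split=> //; split; first by rewrite divnK.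
  by apply: Rle_trans (nat_floor_le _ (Rlt_le _ _ (exp_pos X))); apply: leINR; lia.
pose K := nat_floor (exp (X - u * X)); pose M := nat_floor (exp (u * X)).
have K_le : INR K <= exp (X - u * X) by apply: nat_floor_le; apply: Rlt_le; apply: exp_pos.
have M_le : INR M <= exp (u * X) by apply: nat_floor_le; apply: Rlt_le; apply: exp_pos.
rewrite -(count_predC (fun n => n %/ rank n <= K)%N s) -!size_filter plus_INR Rmult_plus_distr_l.
apply: Rplus_le_compat.
  set s1 := [seq n <- s | _]; have s1_uniq : uniq s1 by exact: filter_uniq.
  rewrite -[INR _]Rmult_1_r -rsum_const (rsum_fiber _ _ _ (iota 0 K.+1) (fun n => n %/ rank n)%N) ?iota_uniq //; last first.
    by move=> n; rewrite mem_filter mem_iota => /andP[].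
  (* The quotient k = 0 is set apart: it does not occur for n > 0. *)
  have -> : iota 0 K.+1 = [:: 0%N] ++ iota 1 K by [].
  rewrite big_cat big_seq1 /= [X in X + _](_ : _ = 0) ?Rplus_0_l; last first.
    rewrite -big_filter big1_seq // => n /andP[_]; rewrite 2!mem_filter => /and3P[/eqP k0 _ n_s].
    by have [n_gt0 [nE _]] := sP n n_s; rewrite nE k0 in n_gt0.
  apply: (Rle_trans _ (\rsum_(k <- iota 1 K) b)).
    apply: rsum_le => k; rewrite mem_iota => /andP[_ k_K] _.
    rewrite -big_filter rsum_const Rmult_1_r.
    apply: (rank_quotient_count X Y k) => //.
    - apply: Rle_trans (leINR k K ltac:(lia)) _; apply: Rle_trans K_le _.
      by apply: exp_le; nra.
    - exact: filter_uniq.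
    - move=> n; rewrite 2!mem_filter => /and3P[/eqP <- _ n_s]; exact: sP.
  rewrite rsum_const size_iota; apply: Rmult_le_compat_r => //; exact/Rlt_le/exp_pos.
set s2 := [seq n <- s | _]; have s2_uniq : uniq s2 by exact: filter_uniq.
have s2P n : n \in s2 -> n \in s /\ exp (X - u * X) < INR (n %/ rank n).
  rewrite mem_filter /= -ltnNge => /andP[k_gt n_s]; split=> //.
  by apply: Rnot_le_lt => /le_nat_floor; rewrite -/K leqNgt k_gt.
have s2M n : n \in s2 -> rank n \in iota 1 M.
  move=> /s2P[n_s k_gt]; have [n_gt0 [nE n_x]] := sP n n_s.
  rewrite mem_iota rank_gt0 // add1n ltnS; apply: le_nat_floor.
  apply: (Rmult_le_reg_l (exp (X - u * X))); first exact: exp_pos.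
  rewrite -exp_plus (_ : _ + _ = X); last lra.
  apply: Rle_trans n_x; rewrite {2}nE INRM; apply: Rmult_le_compat_r; [exact: pos_INR | exact: Rlt_le].
rewrite -[INR _]Rmult_1_r -rsum_const (rsum_fiber _ _ _ (iota 1 M) rank) ?iota_uniq //.
apply: (Rle_trans _ (\rsum_(m <- iota 1 M) (exp (X - u * X) * P * Rpower (INR m) (- (1 - u))))).
  apply: rsum_le => m; rewrite mem_iota => /andP[m_gt0 m_M] _.
  rewrite -big_filter rsum_const Rmult_1_r; set t := [seq n <- s2 | _].
  have tP n : n \in t -> n \in s /\ rank n = m.
    by rewrite mem_filter => /andP[/eqP rn /s2P[]].
  have m_R := INR_gt0 m m_gt0.
  have m_x : INR m <= exp X.
    apply: Rle_trans (leINR m M ltac:(lia)) _; apply: Rle_trans M_le _.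
    by apply: exp_le; nra.
  rewrite -(size_map (fun n => n %/ m)%N t).
  apply: Rle_trans (rank_dvd_count u m (exp X / INR m) _ u_bd m_gt0 _ _) _.
  - rewrite map_inj_in_uniq; first exact: filter_uniq.
    move=> n n' /tP[n_s rn] /tP[n'_s rn'] eq_k.
    have [_ [-> _]] := sP n n_s; have [_ [-> _]] := sP n' n'_s.
    by rewrite rn rn' eq_k.
  - move=> _ /mapP[n /tP[n_s rn] ->]; have [n_gt0 [nE n_x]] := sP n n_s.
    rewrite rn in nE; have k_gt0 : (0 < n %/ m)%N by move: n_gt0; rewrite {1}nE; case: (n %/ m)%N.
    (* Since k divides n, [rank k] divides [rank n], which is m. *)
    split=> //; split; first by rewrite -{2}rn rank_dvd // nE mulnK // dvdn_mulr.
    apply: (Rmult_le_reg_r (INR m)) => //; rewrite -INRM -nE.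
    by rewrite /Rdiv Rmult_assoc Rinv_l ?Rmult_1_r //; lra.
  rewrite (_ : Rpower (exp X / INR m) (1 - u) = exp (X - u * X) * Rpower (INR m) (- (1 - u))); last first.
    rewrite -Rpower_mult_distr; [|exact: exp_pos|exact: Rinv_0_lt_compat].
    rewrite /Rpower ln_exp ln_Rinv //; congr (_ * _); congr exp; lra.
  have c_ge0 : 0 <= exp (X - u * X) * Rpower (INR m) (- (1 - u)).
    by apply: Rmult_le_pos; [exact/Rlt_le/exp_pos | exact/Rlt_le/Rpower_gt0].
  rewrite [X in _ <= X](_ : _ = exp (X - u * X) * Rpower (INR m) (- (1 - u)) * P); last lra.
  apply: Rmult_le_compat_l => //; apply: exp_le.
  apply: Rmult_le_compat_l; first by apply: Rlt_le; apply: Rdiv_lt_0_compat; lra.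
  apply: exp_le; apply: Rmult_le_compat_l; first lra.
  apply: (prime_divisors_sum X Y) => //; lra.
rewrite rsum_scale Rmult_assoc; apply: Rmult_le_compat_l; first exact/Rlt_le/exp_pos.
apply: Rmult_le_compat_l; first exact/Rlt_le/exp_pos.
(* Summing m^-(1 - u) over m <= M <= exp (u X) gives the factor exp (u^2 X) / u. *)
apply: Rle_trans (power_sum_le u M _) _; first lra.
apply: Rmult_le_compat_r; first by apply: Rlt_le; apply: Rinv_0_lt_compat; lra.
case: (M) M_le => [|M'] M_le.
  by rewrite Rpower_0_l -exp_0; apply: exp_le; nra.
apply: (Rle_trans _ (Rpower (exp (u * X)) u)).
  by apply: Rpower_le_base; [split=> //; apply: INR_gt0 | lra].
by rewrite /Rpower ln_exp; apply: exp_le; lra.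
Qed.

(** * Asymptotics and choice of parameters *)

Lemma exp_dominates_square a C : 0 < a ->
  exists M, forall t, M <= t -> 1 <= t -> C * t ^ 2 <= exp (a * t).
Proof.
move=> a_gt0; have a3_gt0 : 0 < (a / 3) ^ 3 by apply: pow_lt; lra.
exists (C / (a / 3) ^ 3) => t t_M t_ge1.
have C_le : C <= t * (a / 3) ^ 3.
  apply: (Rmult_le_reg_r (/ (a / 3) ^ 3)); first exact: Rinv_0_lt_compat.
  by rewrite Rmult_assoc Rinv_r ?Rmult_1_r; lra.
(* Writing exp (a t) as a cube and using exp y >= y yields cubic growth. *)
have -> : a * t = INR 3 * (a / 3 * t) by rewrite /=; lra.
rewrite -exp_INR; apply: (Rle_trans _ ((a / 3 * t) ^ 3)).
  have t2_ge0 : 0 <= t ^ 2 by apply: pow_le; lra.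
  have := Rmult_le_compat_r _ _ _ t2_ge0 C_le.
  by rewrite (_ : (a / 3 * t) ^ 3 = t * (a / 3) ^ 3 * t ^ 2); [lra | ring].
apply: pow_incr; split; first by apply: Rmult_le_pos; lra.
by have := exp_ineq1_le (a / 3 * t); lra.
Qed.

(** The choice of u makes X^(2u) equal to E = Y^(1 - 2d), while Y = E F^2 with F = Y^d. The left
    side is at most 4 (3 + 12 / d) E F, and the spare factor F absorbs the constant. *)
Lemma inner_sum_bound d W Y X u : 0 < d <= 1 / 4 -> 1 <= W -> Y = exp W -> X = exp Y ->
  u = (1 / 2 - d) * (W / Y) -> 0 < u <= 1 / 8 -> 16 * (3 + 12 / d) <= exp (d * W) ->
  4 * (1 + 2 * Rpower (2 * X) (2 * u) * (Rpower (1 + 2 * Y) d / d) + 2 * Rpower X (2 * u))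
  <= Y / 4.
Proof.
move=> d_bd W_ge1 YE XE uE u_bd F_ge.
have Y_ge2 : 2 <= Y by rewrite YE; have := exp_ineq1_le W; lra.
have id_gt0 : 0 < / d by apply: Rinv_0_lt_compat; lra.
set F := exp (d * W) in F_ge; set E := exp ((1 - 2 * d) * W).
have E_ge1 : 1 <= E by have := exp_ineq1_le ((1 - 2 * d) * W); rewrite -/E; nra.
have F_ge1 : 1 <= F by have := exp_ineq1_le (d * W); rewrite -/F; nra.
have YEF : Y = E * F * F by rewrite YE /E /F -!exp_plus; congr exp; lra.
have X_E : Rpower X (2 * u) = E.
  by rewrite /Rpower XE ln_exp uE /E; congr exp; field; lra.
have X_gt0 : 0 < X by rewrite XE; apply: exp_pos.
have X2_E : Rpower (2 * X) (2 * u) <= 2 * E.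
  rewrite -Rpower_mult_distr ?X_E; try lra.
  apply: Rmult_le_compat_r; first lra.
  by rewrite -[X in _ <= X](Rpower_1 2); [apply: Rle_Rpower; lra | lra].
have Y_F : Rpower (1 + 2 * Y) d <= 3 * F.
  apply: (Rle_trans _ (Rpower (3 * Y) d)); first by apply: Rpower_le_base; lra.
  rewrite -Rpower_mult_distr; try lra.
  rewrite [Rpower Y d]/Rpower YE ln_exp -/F; apply: Rmult_le_compat_r; first lra.
  by rewrite -[X in _ <= X](Rpower_1 3); [apply: Rle_Rpower; lra | lra].
have H1 : 2 * Rpower (2 * X) (2 * u) * (Rpower (1 + 2 * Y) d / d) <= 2 * (2 * E) * (3 * F * / d).
  have := Rpower_gt0 (2 * X) (2 * u); have := Rpower_gt0 (1 + 2 * Y) d => ? ?.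
  apply: Rmult_le_compat; rewrite /Rdiv; try lra.
    by apply: Rmult_le_pos; lra.
  by apply: Rmult_le_compat_r; lra.
have EF_ge : 0 < E * F by apply: Rmult_lt_0_compat; lra.
have H2 := Rmult_le_compat_l (E * F) _ _ (Rlt_le _ _ EF_ge) F_ge.
rewrite X_E [X in _ <= X / 4]YEF; rewrite /Rdiv in H1 H2 *.
have H3 : 1 <= E * F by rewrite -[1]Rmult_1_l; apply: Rmult_le_compat; lra.
have H4 : E <= E * F by rewrite -{1}[E]Rmult_1_r; apply: Rmult_le_compat_l; lra.
lra.
Qed.

(** With T = X W / Y, each of the two summands is at most exp (d T - 1), hence at most half of exp
    (d T). *)
Lemma sum_bound_eventually d : 0 < d <= 1 / 4 ->
  exists M, 1 <= M /\ forall W Y X u, M <= W -> Y = exp W -> X = exp Y ->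
    u = (1 / 2 - d) * (W / Y) ->
  [/\ 2 <= Y, 0 < u <= 1 / 4 &
    exp (2 * X / Y + (2 * Y * exp (Y / 2) + 2 * (X + 30) / Y)) +
    exp (28 / u * exp (4 * (1 + 2 * Rpower (2 * X) (2 * u) *
        (Rpower (1 + 2 * Y) d / d) + 2 * Rpower X (2 * u)))) * (exp (u * u * X) / u)
    <= exp (d * (X * W / Y))].
Proof.
move=> d_bd; have id_gt0 : 0 < / d by apply: Rinv_0_lt_compat; lra.
have [M1 HM1] := exp_dominates_square 1 (/ d) ltac:(lra).
have [M2 HM2] := exp_dominates_square d (16 * (3 + 12 / d)) ltac:(lra).
have [M3 HM3] := exp_dominates_square (1 / 4) 200 ltac:(lra).
(* The thresholds give, in order, W <= d Y, the hypothesis of [inner_sum_bound], 200 Y^2 <= exp (Y /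
   4), and d W >= 16. *)
pose M := 1 + Rabs M1 + Rabs M2 + Rabs M3 + 16 / d.
have Rabs_bd := (Rle_abs M1, Rle_abs M2, Rle_abs M3).
have Rabs_ge0 := (Rabs_pos M1, Rabs_pos M2, Rabs_pos M3).
have d16_gt0 : 0 < 16 / d by rewrite /Rdiv; lra.
case: Rabs_bd Rabs_ge0 => [[B1 B2] B3] [[P1 P2] P3].
exists M; split=> [|W Y X u W_M YE XE uE]; first by rewrite /M; lra.
rewrite /M in W_M; have W_ge1 : 1 <= W by lra.
have Y_W : 1 + W <= Y by rewrite YE; apply: exp_ineq1_le.
have dW : 16 <= d * W.
  have -> : 16 = d * (16 / d) by field; lra.
  by apply: Rmult_le_compat_l; lra.
have W_dY : W <= d * Y.
  have := HM1 W ltac:(lra) W_ge1; rewrite Rmult_1_l -YE => H.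
  have : d * (/ d * W ^ 2) <= d * Y by apply: Rmult_le_compat_l; lra.
  by rewrite -Rmult_assoc Rinv_r; [nra | lra].
have F_ge : 16 * (3 + 12 / d) <= exp (d * W).
  apply: Rle_trans (HM2 W ltac:(lra) W_ge1).
  have : 0 < 12 / d by rewrite /Rdiv; lra.
  nra.
have iY_gt0 : 0 < / Y by apply: Rinv_0_lt_compat; lra.
have WY_le : W / Y <= d by apply: (Rmult_le_reg_r Y); rewrite /Rdiv ?Rmult_assoc ?Rinv_l; lra.
have WY_gt0 : 0 < W / Y by apply: Rmult_lt_0_compat; lra.
have u_bd : 0 < u <= 1 / 8 by rewrite uE; split; nra.
split; [lra | lra |].
have S_le := inner_sum_bound d W Y X u d_bd W_ge1 YE XE uE u_bd F_ge.
set S := 4 * (1 + _ + _) in S_le *.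
(* In terms of G everything is polynomial: X = G^4, and [inner_sum_bound] gives exp S <= G. *)
set G := exp (Y / 4).
have G_ge : 200 * Y ^ 2 <= G.
  rewrite /G (_ : Y / 4 = 1 / 4 * Y); last lra.
  by apply: HM3; lra.
have XG : X = G ^ 4 by rewrite XE exp_INR /=; congr exp; lra.
have X2G : exp (Y / 2) = G ^ 2 by rewrite exp_INR /=; congr exp; lra.
set T := X * W / Y.
set Q := X / Y.
have QE : Q * Y = X by rewrite /Q; field; lra.
have TE : T = Q * W by rewrite /T /Q; field; lra.
have G_gt0 : 0 < G by exact: exp_pos.
have Q_ge : 200 * Y * G ^ 3 <= Q.
  apply: (Rmult_le_reg_r Y); first lra.
  rewrite QE XG; have : 0 < G ^ 3 by apply: pow_lt.
  by nra.
have G_ge1 : 1 <= G by nra.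
have G2_ge : G <= G ^ 2 by nra.
have G3_ge : G ^ 2 <= G ^ 3 by nra.
have Q_gt0 : 0 < Q by nra.
have dT : 16 * Q <= d * T by rewrite TE; nra.
have iu_le : / u <= 4 * Y.
  have : / 4 * / Y <= u by rewrite uE /Rdiv; nra.
  rewrite -Rinv_mult => H; rewrite -(Rinv_inv (4 * Y)); apply: Rinv_le_contravar => //.
  by apply: Rinv_0_lt_compat; lra.
have iu_gt0 : 0 < / u by apply: Rinv_0_lt_compat; lra.
have YG3 : Y * G <= Y * G ^ 3 /\ Y * G ^ 2 <= Y * G ^ 3 /\ 2 <= Y * G ^ 3 by split; [nra | split; nra].
have YG : Y <= Y * G by nra.
have le1 : 2 * X / Y + (2 * Y * exp (Y / 2) + 2 * (X + 30) / Y) <= d * T - 1.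
  have -> : 2 * X / Y + (2 * Y * exp (Y / 2) + 2 * (X + 30) / Y) = 4 * Q + 2 * (Y * G ^ 2) + 60 * / Y.
    by rewrite X2G /Q; field; lra.
  have : / Y <= 1 by rewrite -Rinv_1; apply: Rinv_le_contravar; lra.
  lra.
(* The summand 1 / u in the exponent pays for the division by u, as 1 / u <= exp (1 / u). *)
have le2 : 28 / u * exp S + u * u * X + / u <= d * T - 1.
  have eS : exp S <= G by apply: exp_le.
  have l1 : 28 / u * exp S <= 112 * (Y * G).
    have -> : 112 * (Y * G) = 28 * (4 * Y) * G by lra.
    apply: Rmult_le_compat => //; rewrite /Rdiv; try lra.
    exact/Rlt_le/exp_pos.
  have l2 : u * u * X <= d * T / 4.
    have -> : d * T / 4 = / 4 * (W / Y * d) * X by rewrite TE /Q; field; lra.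
    apply: Rmult_le_compat_r; first by rewrite XE; exact/Rlt_le/exp_pos.
    have u_le : u <= / 2 * (W / Y) by rewrite uE; apply: Rmult_le_compat_r; lra.
    apply: (Rle_trans _ ((/ 2 * (W / Y)) * (/ 2 * d))); last lra.
    by apply: Rmult_le_compat; lra.
  lra.
have half : exp (d * T - 1) <= exp (d * T) / 2.
  rewrite /Rminus exp_plus exp_Ropp /Rdiv. apply: Rmult_le_compat_l; first exact/Rlt_le/exp_pos.
  by apply: Rinv_le_contravar; [lra | exact: two_le_exp1].
have L1 := Rle_trans _ _ _ (exp_le _ _ le1) half.
have L2 : exp (28 / u * exp S) * (exp (u * u * X) / u) <= exp (d * T) / 2.
  apply: Rle_trans half; apply: Rle_trans (exp_le _ _ le2).
  rewrite !exp_plus (Rmult_assoc (exp (28 / u * exp S))); apply: Rmult_le_compat_l; first exact/Rlt_le/exp_pos.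
  apply: Rmult_le_compat_l; first exact/Rlt_le/exp_pos.
  by have := exp_ineq1_le (/ u); lra.
lra.
Qed.

Lemma ln_le x y : 0 < x -> x <= y -> ln x <= ln y.
Proof. by move=> x_gt0 [/(ln_increasing _ _ x_gt0)|->]; lra. Qed.

Lemma A_gt0 x : 1 <= x -> (0 < A x)%N.
Proof.
move=> x_ge1; rewrite A_size size_filter -has_count; apply/hasP; exists 1%N.
  by rewrite mem_iota /= add1n ltnS le_nat_floor.
by rewrite dvdn_rank.
Qed.

(** One d is lost in u, where u X = (1/2 - d) T, and another in [sum_bound_eventually]. *)
Lemma ln_A_le d : 0 < d <= 1 / 4 -> exists x0, 1 <= x0 /\ forall x, x0 <= x ->
  0 < ln x * ln (ln (ln x)) / ln (ln x) /\
  ln (INR (A x)) <= ln x - (1 / 2 - 2 * d) * (ln x * ln (ln (ln x)) / ln (ln x)).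
Proof.
move=> d_bd; have [M [M_ge1 HM]] := sum_bound_eventually d d_bd.
exists (exp (exp (exp M))).
split=> [|x x_M].
  by have := exp_ineq1_le (exp (exp M)); have := exp_pos (exp M); lra.
have x_gt0 : 0 < x by apply: Rlt_le_trans x_M; apply: exp_pos.
have ln_ge y z : exp y <= z -> y <= ln z.
  move=> y_z; rewrite -(ln_exp y); apply: ln_le => //; exact: exp_pos.
have X_M := ln_ge _ _ x_M; have Y_M := ln_ge _ _ X_M; have W_M := ln_ge _ _ Y_M.
have X_gt0 : 0 < ln x by apply: Rlt_le_trans X_M; apply: exp_pos.
have Y_gt0 : 0 < ln (ln x) by apply: Rlt_le_trans Y_M; apply: exp_pos.
set X := ln x in X_M Y_M W_M X_gt0 Y_gt0 *; set Y := ln X in Y_M W_M Y_gt0 *.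
set W := ln Y in W_M *.
have XE : X = exp Y by rewrite exp_ln.
have YE : Y = exp W by rewrite exp_ln.
have [Y_ge2 u_bd S_le] := HM W Y X _ W_M YE XE erefl.
set u := (1 / 2 - d) * (W / Y) in u_bd S_le.
have T_gt0 : 0 < X * W / Y.
  by apply: Rdiv_lt_0_compat => //; apply: Rmult_lt_0_compat; lra.
split=> //.
have := self_fib_count X Y u d XE Y_ge2 u_bd ltac:(lra).
rewrite {1}/X exp_ln // => A_le.
have {A_le}A_le : INR (A x) <= exp (X - (1 / 2 - 2 * d) * (X * W / Y)).
  apply: Rle_trans A_le _.
  apply: Rle_trans (Rmult_le_compat_l _ _ _ (Rlt_le _ _ (exp_pos _)) S_le) _.
  rewrite -exp_plus; apply: Req_le; congr exp; rewrite /u; field; lra.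
rewrite -(ln_exp (X - _)); apply: ln_le => //; apply: INR_gt0; apply: A_gt0.
by apply: Rle_trans x_M; have := exp_ineq1_le (exp (exp M)); have := exp_pos (exp M); lra.
Qed.

Theorem theorem1p2 :
  exists eps : R -> R,
    (forall e : R, 0 < e -> exists M : R, forall x : R, M <= x -> Rabs (eps x) < e) /\
    exists x0 : R, 1 <= x0 /\
      forall x : R, x0 <= x ->
        ln (INR (A x)) <=
          ln x - (1/2 + eps x) * (ln x * ln (ln (ln x)) / ln (ln x)).
Proof.
pose T x := ln x * ln (ln (ln x)) / ln (ln x).
(* The exact saving relative to T, capped at 0: the inequality then holds by construction, and
   convergence needs only the lower bound -2 d of [ln_A_le]. *)
pose eps x := Rmin 0 ((ln x - ln (INR (A x))) / T x - 1 / 2).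
exists eps; split.
  move=> e e_gt0; pose d := Rmin (1 / 4) (e / 4).
  have d_bd : 0 < d <= 1 / 4.
    by split; [apply: Rmin_glb_lt; lra | exact: Rmin_l].
  have d_e : d <= e / 4 by exact: Rmin_r.
  have [x0 [_ Hx0]] := ln_A_le d d_bd; exists x0 => x /Hx0[T_gt0 A_le].
  rewrite -/(T x) in T_gt0 A_le.
  have le_q : 1 / 2 - 2 * d <= (ln x - ln (INR (A x))) / T x.
    by apply: (Rmult_le_reg_r (T x)) => //; rewrite /Rdiv Rmult_assoc Rinv_l; lra.
  rewrite /eps; move: (Rmin_l 0 ((ln x - ln (INR (A x))) / T x - 1 / 2)).
  have : - (2 * d) <= Rmin 0 ((ln x - ln (INR (A x))) / T x - 1 / 2) by apply: Rmin_glb; lra.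
  by move=> ? ?; apply: Rabs_def1; lra.
have [x0 [x0_ge1 Hx0]] := ln_A_le (1 / 4) ltac:(lra).
exists x0; split=> // x /Hx0[T_gt0 _]; rewrite -/(T x) in T_gt0 *.
have := Rmin_r 0 ((ln x - ln (INR (A x))) / T x - 1 / 2); rewrite -/(eps x) => eps_le.
have : (1 / 2 + eps x) * T x <= (ln x - ln (INR (A x))) / T x * T x.
  by apply: Rmult_le_compat_r; lra.
by rewrite /Rdiv Rmult_assoc Rinv_l; lra.
Qed.
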